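(* Let $G$ be a finitely generated group and let $\varphi:A\to B$ be an isomorphism between finite subgroups $A,B$ of $G$. Suppose there exists $g\in G$ with $g^{-1}Ag\cap A=1$ or $g^{-1}Ag\cap B=1$. Then the rational subset membership problem and the submonoid membership problem are recursively equivalent for the HNN extension $\ast_{\varphi}G$.
   Context: The HNN extension $\ast_\varphi G$ with base $G$, stable letter $t$ and associated subgroups $A,B$ is the quotient $(G\ast\langle t\rangle)/\{t^{-1}at=\varphi(a)\mid a\in A\}$, where $t$ generates an infinite cyclic group. Let $K$ be a group generated by a finite set $\Sigma$, let $\Sigma^{\pm1}=\Sigma\cup\Sigma^{-1}$ with $\Sigma^{-1}$ a disjoint copy of formal inverses, and let $\eta:(\Sigma^{\pm1})^*\to K$ be the canonical monoid homomorphism. The submonoid membership problem for $K$: given a finite set $\Delta\subseteq(\Sigma^{\pm1})^*$ and a word $w\in(\Sigma^{\pm1})^*$, is $\eta(w)\in\eta(\Delta^* )$? The rational subset membership problem for $K$: given a finite automaton $M$ over $\Sigma^{\pm1}$ and a word $w\in(\Sigma^{\pm1})^*$, is $\eta(w)\in\eta(L(M))$? Decidability of these problems does not depend on the choice of $\Sigma$. Two decision problems are recursively equivalent if each can be algorithmically (Turing) reduced to the other. *)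

(* Defs.v *)
From HB Require Import structures.
From mathcomp Require Import all_boot.
From mathcomp Require Import boolp classical_sets functions cardinality.

Set Implicit Arguments.
Unset Strict Implicit.
Unset Printing Implicit Defensive.

Local Open Scope classical_set_scope.
Local Open Scope quotient_scope.
Local Open Scope group_scope.

(* Words over the disjoint union of [G] and {t, t^-1}: [inr false] is the
   stable letter t and [inr true] its formal inverse. *)
Notation hnn_word G := (seq (G + bool)%type) (only parsing).

(* The least monoid congruence making [inl] a monoid morphism (of G) and
   [inr true] an inverse of [inr false], which presents the free product
   G * <t>, and identifying t^-1 a t with phi a for all a in A.  Only the
   restriction of [phi] to [A] matters. *)
Inductive hnn_cong (G : groupType) (A : set G) (phi : G -> G) :
    hnn_word G -> hnn_word G -> Prop :=
| HnnRefl u : hnn_cong A phi u u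
| HnnSym u v : hnn_cong A phi u v -> hnn_cong A phi v u
| HnnTrans u v w :
    hnn_cong A phi u v -> hnn_cong A phi v w -> hnn_cong A phi u w
| HnnCat u u' v v' : hnn_cong A phi u u' -> hnn_cong A phi v v' ->
    hnn_cong A phi (u ++ v) (u' ++ v')
| HnnOne : hnn_cong A phi [:: inl 1] [::]
| HnnMul x y : hnn_cong A phi [:: inl x; inl y] [:: inl (x * y)]
| HnnCancel b : hnn_cong A phi [:: inr b; inr (~~ b)] [::]
| HnnConj a : A a ->
    hnn_cong A phi [:: inr true; inl a; inr false] [:: inl (phi a)].

Section HNN.
Variables (G : groupType) (A : set G) (phi : G -> G).

Definition hnn_rel : rel (hnn_word G) := fun u v => `[< hnn_cong A phi u v >].

Lemma hnn_rel_refl : reflexive hnn_rel.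
Proof. by move=> u; apply/asboolP; apply: HnnRefl. Qed.

Lemma hnn_rel_sym : symmetric hnn_rel.
Proof.
by move=> u v; apply/asboolP/asboolP => uv; apply: HnnSym.
Qed.

Lemma hnn_rel_trans : transitive hnn_rel.
Proof.
by move=> v u w /asboolP uv /asboolP vw; apply/asboolP; apply: HnnTrans uv vw.
Qed.

Canonical hnn_equiv := EquivRel hnn_rel hnn_rel_refl hnn_rel_sym hnn_rel_trans.

Definition hnn : Type := {eq_quot hnn_equiv}.

HB.instance Definition _ := Choice.on hnn.
HB.instance Definition _ := EqQuotient.on hnn.

Implicit Types (u v : hnn_word G) (x y z : hnn).

Definition hnn_pi u : hnn := \pi_hnn u.

Lemma hnn_piP u v : hnn_pi u = hnn_pi v <-> hnn_cong A phi u v.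
Proof.
by split=> [/eqmodP/asboolP | uv]; last by apply/eqmodP/asboolP.
Qed.

Lemma hnn_piK x : hnn_pi (repr x) = x.
Proof. exact: reprK. Qed.

Definition hnn_mul x y : hnn := hnn_pi (repr x ++ repr y).

Lemma hnn_pi_cat u v : hnn_pi (u ++ v) = hnn_mul (hnn_pi u) (hnn_pi v).
Proof.
by apply/hnn_piP/HnnCat; apply/hnn_piP; rewrite hnn_piK.
Qed.

Definition hnn_letter_inv (l : G + bool) : G + bool :=
  match l with inl x => inl x^-1 | inr b => inr (~~ b) end.

Definition hnn_word_inv u : hnn_word G := rev (map hnn_letter_inv u).

Definition hnn_inv x : hnn := hnn_pi (hnn_word_inv (repr x)).

Lemma hnn_mulA : associative hnn_mul.
Proof.
move=> x y z; rewrite -[x]hnn_piK -[y]hnn_piK -[z]hnn_piK.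
by rewrite -!hnn_pi_cat catA.
Qed.

Lemma hnn_mul1 : left_id (hnn_pi [::]) hnn_mul.
Proof. by move=> x; rewrite -[x]hnn_piK -hnn_pi_cat. Qed.

Lemma hnn_mulr1 : right_id (hnn_pi [::]) hnn_mul.
Proof. by move=> x; rewrite -[x]hnn_piK -hnn_pi_cat cats0. Qed.

Lemma hnn_letterV l : hnn_cong A phi [:: l; hnn_letter_inv l] [::].
Proof.
case: l => [x|b] /=; last exact: HnnCancel.
by apply: HnnTrans (HnnMul _ _ _ _) _; rewrite mulgV; apply: HnnOne.
Qed.

Lemma hnn_letterK : involutive hnn_letter_inv.
Proof. by case=> [x|b] /=; rewrite ?invgK ?negbK. Qed.

Lemma hnn_word_invK : involutive hnn_word_inv.
Proof.
by move=> u; rewrite /hnn_word_inv map_rev revK (mapK hnn_letterK).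
Qed.

Lemma hnn_wordV u : hnn_cong A phi (u ++ hnn_word_inv u) [::].
Proof.
elim: u => [|l u IHu] /=; first exact: HnnRefl.
rewrite /hnn_word_inv /= rev_cons -cats1 catA.
have lV := hnn_letterV l; apply: HnnTrans lV.
rewrite -[l :: _]/([:: l] ++ (_ ++ [:: hnn_letter_inv l])).
rewrite -[X in hnn_cong _ _ _ X]/([:: l] ++ ([::] ++ [:: hnn_letter_inv l])).
by apply: HnnCat (HnnRefl _ _ _) (HnnCat IHu (HnnRefl _ _ _)).
Qed.

Lemma hnn_mulV : right_inverse (hnn_pi [::]) hnn_inv hnn_mul.
Proof.
move=> x; rewrite -{1}[x]hnn_piK -hnn_pi_cat.
exact/hnn_piP/hnn_wordV.
Qed.

Lemma hnn_Vmul : left_inverse (hnn_pi [::]) hnn_inv hnn_mul.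
Proof.
move=> x; rewrite -{2}[x]hnn_piK -hnn_pi_cat; apply/hnn_piP.
by rewrite -{2}[repr x]hnn_word_invK; apply: hnn_wordV.
Qed.

HB.instance Definition _ := isGroup.Build hnn
  hnn_mulA hnn_mul1 hnn_mulr1 hnn_Vmul hnn_mulV.

End HNN.

Section WordProblems.
Variables (K : groupType) (n : nat) (s : 'I_n -> K).

(* Sigma is enumerated by [s]; the letter [(i, false)] stands for the i-th
   generator and [(i, true)] for its formal inverse. *)
Definition letter : Type := 'I_n * bool.

HB.instance Definition _ := Equality.on letter.

Definition letter_val (l : letter) : K := if l.2 then (s l.1)^-1 else s l.1.

Definition eta (w : seq letter) : K := \prod_(l <- w) letter_val l.

Definition generates : Prop := forall x : K, exists w, eta w = x.

(* Delta^* as a set of words *)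
Definition star (D : seq (seq letter)) : set (seq letter) :=
  [set w | exists2 ws : seq (seq letter), {subset ws <= D} & w = flatten ws].

Definition submonoid_membership (D : seq (seq letter)) (w : seq letter) : Prop :=
  (eta @` star D) (eta w).

(* The states are natural numbers, only finitely many of which matter. *)
Record automaton : Type := Automaton {
  initial : seq nat;
  final : seq nat;
  transitions : seq (nat * letter * nat)
}.

Fixpoint run (M : automaton) (p : nat) (w : seq letter) (q : nat) : Prop :=
  match w with
  | [::] => p = q
  | l :: w' => exists2 r, (p, l, r) \in transitions M & run M r w' q
  end.

Definition language (M : automaton) : set (seq letter) :=
  [set w | exists p q, [/\ p \in initial M, q \in final M & run M p w q]].

Definition rational_membership (M : automaton) (w : seq letter) : Prop :=
  (eta @` language M) (eta w).

(* Goedel numbering of the instances; [CodeSeq.code] is a computable bijection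
   from finite sequences of naturals to naturals. *)
Definition code_letter (l : letter) : nat := (l.1.*2 + l.2)%N.

Definition code_word (w : seq letter) : nat :=
  CodeSeq.code (map code_letter w).

Definition code_transition (e : nat * letter * nat) : nat :=
  CodeSeq.code [:: e.1.1; code_letter e.1.2; e.2].

Definition code_automaton (M : automaton) : nat :=
  CodeSeq.code [:: CodeSeq.code (initial M); CodeSeq.code (final M);
                   CodeSeq.code (map code_transition (transitions M))].

Definition submonoid_problem : set nat :=
  [set x | exists D w, x = CodeSeq.code
             [:: CodeSeq.code (map code_word D); code_word w] /\
           submonoid_membership D w].

Definition rational_problem : set nat :=
  [set x | exists M w, x = CodeSeq.code [:: code_automaton M; code_word w] /\
           rational_membership M w].

End WordProblems.

Section Oracle.
Local Open Scope nat_scope.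

(* Partial mu-recursive functions with an oracle: the argument of the type is
   the arity. *)
Inductive mu_rec : nat -> Type :=
| Zero k : mu_rec k
| Succ : mu_rec 1
| Proj k (i : 'I_k) : mu_rec k
| Oracle : mu_rec 1
| Comp k m (f : mu_rec m) (g : 'I_m -> mu_rec k) : mu_rec k
| Prec k (f : mu_rec k) (g : mu_rec k.+2) : mu_rec k.+1
| Mu k (f : mu_rec k.+1) : mu_rec k.

Fixpoint prim_rec_graph (base : nat -> Prop) (step : nat -> nat -> nat -> Prop)
    (n y : nat) : Prop :=
  match n with
  | 0 => base y
  | n'.+1 => exists2 z, prim_rec_graph base step n' z & step n' z y
  end.

(* [eval O p v y]: with oracle O, program p halts on input v with output y. *)
Fixpoint eval (O : nat -> nat) k (p : mu_rec k) : k.-tuple nat -> nat -> Prop :=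
  match p in mu_rec k return k.-tuple nat -> nat -> Prop with
  | Zero _ => fun _ y => y = 0
  | Succ => fun v y => y = (thead v).+1
  | Proj _ i => fun v y => y = tnth v i
  | Oracle => fun v y => y = O (thead v)
  | Comp _ m f g => fun v y =>
      exists2 w : m.-tuple nat, forall i, eval O (g i) v (tnth w i) &
        eval O f w y
  | Prec _ f g => fun v y =>
      prim_rec_graph (eval O f (behead_tuple v))
        (fun n z => eval O g [tuple of n :: z :: behead_tuple v]) (thead v) y
  | Mu _ f => fun v y =>
      eval O f [tuple of y :: v] 0 /\
      forall z, z < y -> exists u, eval O f [tuple of z :: v] u.+1
  end.

Definition char_fun (P : set nat) (x : nat) : nat := `[< P x >].

Definition turing_reducible (P Q : set nat) : Prop :=
  exists p : mu_rec 1,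
    forall x, eval (char_fun Q) p [tuple x] (char_fun P x).

Definition recursively_equivalent (P Q : set nat) : Prop :=
  turing_reducible P Q /\ turing_reducible Q P.

End Oracle.

Definition is_subgroup (G : groupType) (A : set G) : Prop :=
  group_closed (mem A).

Definition is_isomorphism (G : groupType) (A B : set G) (phi : G -> G) : Prop :=
  set_bij A B phi /\ {in A &, {morph phi : x y / x * y}}.

Definition finitely_generated (G : groupType) : Prop :=
  exists n (s : 'I_n -> G), generates s.

Definition conj_set (G : groupType) (A : set G) (g : G) : set G :=
  [set a ^ g | a in A].

(* Main.v *)
Require Import Defs.
From HB Require Import structures.
From mathcomp Require Import all_boot.
From mathcomp Require Import boolp classical_sets functions cardinality.

Set Implicit Arguments.
Unset Strict Implicit.
Unset Printing Implicit Defensive.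

(** Write K for the HNN extension, t for its stable letter, and call A and B
    the associated subgroups.

    The submonoid problem reduces to the rational subset problem in every
    group: D^* is the language of an automaton whose states are the suffixes
    of the words of D that remain to be read ([star_walk]).

    For the converse, append the inverse of w to the automaton M: the question
    becomes whether 1 is the value of a path between two fixed vertices of a
    finite graph whose edges carry letters from G and powers t^+1, t^-1.  By
    Britton's lemma, a word of value 1 that involves t contains a factor
    t^-e y t^e, where y is a word over G whose value lies in an associated
    subgroup.  These subgroups are finite, so every such detour can be
    short-circuited by one of finitely many new edges labelled in A or B.
    Once no edge can be added, a path of value 1 can be replaced by one that
    uses only edges labelled in G ([walk_closed], [saturate_correct]).

    Each step of this saturation, and the final answer, need only know
    whether a path labelled in G and of value x leads from p to q.  Suppose
    that K has elements c_p, one for each vertex, such that G and the c_p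
    generate the free product of G and of the free group on the c_p.  Then
    such a path exists if and only if c_p x c_q^-1 belongs to the submonoid
    generated by the c_p' y c_q'^-1, for the edges labelled y from p' to q'
    ([edge_of_product]), and this is a submonoid question in K.  The condition
    on the conjugates of A is what makes the c_p exist: conjugation by a
    suitable word d in t and g takes every nontrivial element of G to an
    element whose reduced form begins and ends with t or t^-1, after which words
    in t and an element h outside both associated subgroups serve to separate the
    c_p ([free_or_trivial], [ends_block]).  The only exception is G = 1; then
    the paths in question are decided by reachability, which the saturation
    computes by itself ([local_query_decides]).

    Britton's lemma enters through the right action of K on normal forms
    ([act_cong]): both the analysis of paths and the freeness of the c_p
    follow the normal form of the prefixes of a word.

    The reductions have to be oracle programs.  A function between countable
    types is called [computable] when a program computes it on codes; this
    class is closed under the usual functions on sequences, so that the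
    reductions can be written as ordinary functions.  *)

(** * Functions computable with an oracle *)

Section Computability.
Variable O : nat -> nat.

Definition recfun k (F : k.-tuple nat -> nat) :=
  exists p : mu_rec k, forall v, eval O p v (F v).

Lemma recfun_ext k (F F' : k.-tuple nat -> nat) :
  F =1 F' -> recfun F -> recfun F'.
Proof. by move=> eqF [p pF]; exists p => v; rewrite -eqF. Qed.

Lemma recfun_proj k (i : 'I_k) : recfun (fun v => tnth v i).
Proof. by exists (Proj i). Qed.

Lemma recfun_comp m k (F : m.-tuple nat -> nat) (G : 'I_m -> k.-tuple nat -> nat) :
  recfun F -> (forall i, recfun (G i)) ->
  recfun (fun v => F [tuple G i v | i < m]).
Proof.
move=> [p pF] /choice[q qG]; exists (Comp p q) => v /=.
by exists [tuple G i v | i < m] => // i; rewrite tnth_mktuple.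
Qed.

(** Curried versions, in which the closure lemmas are easier to apply. *)
Definition rec1 (f : nat -> nat) :=
  recfun (fun v : 1.-tuple nat => f (tnth v ord0)).
Definition rec2 (f : nat -> nat -> nat) :=
  recfun (fun v : 2.-tuple nat => f (tnth v ord0) (tnth v (@Ordinal 2 1 isT))).
Definition rec3 (f : nat -> nat -> nat -> nat) :=
  recfun (fun v : 3.-tuple nat =>
    f (tnth v ord0) (tnth v (@Ordinal 3 1 isT)) (tnth v (@Ordinal 3 2 isT))).

Lemma recfun_app1 k f (G : k.-tuple nat -> nat) :
  rec1 f -> recfun G -> recfun (fun v => f (G v)).
Proof.
move=> rf rG; have := recfun_comp rf (fun _ : 'I_1 => rG).
by apply: recfun_ext => v; rewrite tnth_mktuple.
Qed.

Lemma recfun_app2 k f (G H : k.-tuple nat -> nat) :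
  rec2 f -> recfun G -> recfun H -> recfun (fun v => f (G v) (H v)).
Proof.
move=> rf rG rH.
have rGH (i : 'I_2) : recfun (if i == ord0 then G else H) by case: ifP.
have := recfun_comp rf rGH.
by apply: recfun_ext => v; rewrite !tnth_mktuple.
Qed.

Lemma rec_succ : rec1 succn.
Proof. by exists Succ => v; rewrite /thead. Qed.

Lemma recfun_const k c : recfun (fun _ : k.-tuple nat => c).
Proof.
elim: c => [|c IHc]; first by exists (Zero k).
exact: recfun_app1 rec_succ IHc.
Qed.

Lemma rec2_prec (f : nat -> nat) (g : nat -> nat -> nat -> nat) :
  rec1 f -> rec3 g ->
  rec2 (fun n b => nat_rect (fun _ => nat) (f b) (fun m z => g m z b) n).
Proof.
move=> [p pf] [q qg]; exists (Prec p q) => v /=; rewrite /thead.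
elim: (tnth v ord0) => [|m IHm] /=.
  suff -> : tnth v (@Ordinal 2 1 isT) = tnth (behead_tuple v) ord0 by apply: pf.
  by rewrite tnth_behead; congr (tnth v _); apply: val_inj; rewrite /= inordK.
eexists; first exact: IHm.
set z := nat_rect _ _ _ m.
have := qg [tuple of m :: z :: behead_tuple v].
by rewrite !(tnth_nth 0) /= nth_behead.
Qed.

Lemma rec1_prec c (g : nat -> nat -> nat) :
  rec2 g -> rec1 (nat_rect (fun _ => nat) c g).
Proof.
move=> rg.
have rg3 : rec3 (fun m z _ => g m z).
  by apply: (recfun_app2 rg); apply: recfun_proj.
have := rec2_prec (recfun_const _ c) rg3 => r2.
by have := recfun_app2 r2 (recfun_proj ord0) (recfun_proj (@ord0 0)).
Qed.

Lemma rec_add : rec2 addn.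
Proof.
have r := @rec2_prec id (fun _ z _ => z.+1) (recfun_proj _)
  (recfun_app1 rec_succ (recfun_proj _)).
by apply: recfun_ext r => v; elim: (tnth v ord0) => [|m IHm] //=; rewrite IHm.
Qed.

Lemma rec_double : rec1 double.
Proof.
apply: recfun_ext (recfun_app2 rec_add (recfun_proj _) (recfun_proj _)) => v.
by rewrite -addnn.
Qed.

Lemma rec_pred : rec1 predn.
Proof.
have r := @rec1_prec 0 (fun m _ => m) (recfun_proj _).
by apply: recfun_ext r => v; case: (tnth v ord0).
Qed.

Lemma rec_eq0 : rec1 (fun n => n == 0).
Proof.
have r := @rec1_prec 1 (fun _ _ => 0) (recfun_const _ _).
by apply: recfun_ext r => v; case: (tnth v ord0).
Qed.

Lemma rec_sub : rec2 subn.
Proof.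
have r := @rec2_prec id (fun _ z _ => z.-1) (recfun_proj _)
  (recfun_app1 rec_pred (recfun_proj _)).
have := recfun_app2 r (recfun_proj (@Ordinal 2 1 isT)) (recfun_proj ord0).
apply: recfun_ext => v; elim: (tnth v (Ordinal _)) => [|m IHm] /=.
  by rewrite subn0.
by rewrite IHm subnS.
Qed.

Lemma rec_odd : rec1 odd.
Proof.
have r := @rec1_prec 0 (fun _ z => z == 0) (recfun_app1 rec_eq0 (recfun_proj _)).
apply: recfun_ext r => v; elim: (tnth v ord0) => [|m IHm] //=.
by rewrite IHm; case: (odd m).
Qed.

Lemma rec_half : rec1 half.
Proof.
have r := @rec1_prec 0 (fun m z => odd m + z) (recfun_app2 rec_add
  (recfun_app1 rec_odd (recfun_proj _)) (recfun_proj _)).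
apply: recfun_ext r => v; elim: (tnth v ord0) => [|m IHm] //=.
by rewrite IHm uphalf_half.
Qed.

Lemma rec_mu (f : nat -> nat -> nat) (g : nat -> nat) :
  rec2 f -> (forall b, f (g b) b = 0) ->
  (forall b z, z < g b -> f z b != 0) -> rec1 g.
Proof.
move=> [p pf] fg0 fgN0; exists (Mu p) => v /=; split.
  have := pf [tuple of g (tnth v ord0) :: v].
  by rewrite !(tnth_nth 0) /= fg0.
move=> z /fgN0; have := pf [tuple of z :: v].
rewrite !(tnth_nth 0) /= .
by case: (f z _) => // u; exists u.
Qed.

(** [CodeSeq.code (a :: s)] is [ccons a (CodeSeq.code s)], so this function, its
    two inverses and 0 are all that programs need to know about codes. *)
Definition ccons a b := 2 ^ a * b.*2.+1.
Definition chead n := head 0 (CodeSeq.decode n).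
Definition ctail n := CodeSeq.code (behead (CodeSeq.decode n)).

Lemma rec_ccons : rec2 ccons.
Proof.
have r := @rec2_prec (fun b => b.*2.+1) (fun _ z _ => z.*2)
  (recfun_app1 rec_succ (recfun_app1 rec_double (recfun_proj _)))
  (recfun_app1 rec_double (recfun_proj _)).
apply: recfun_ext r => v; rewrite /ccons.
elim: (tnth v ord0) => [|m IHm] /=; first by rewrite mul1n.
by rewrite IHm expnS -mulnA mul2n.
Qed.

Lemma iter_half_ccons a b k : k <= a -> iter k half (ccons a b) = ccons (a - k) b.
Proof.
elim: k => [|k IHk] le_ka; first by rewrite subn0.
rewrite iterS IHk 1?ltnW // -(subnSK le_ka) /ccons.
by rewrite expnS -mulnA mul2n doubleK.
Qed.

Lemma rec_iter_half : rec2 (fun k => iter k half).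
Proof.
have r := @rec2_prec id (fun _ z _ => z./2) (recfun_proj _)
  (recfun_app1 rec_half (recfun_proj _)).
by apply: recfun_ext r => v; elim: (tnth v ord0) => [|m IHm] //=; rewrite IHm.
Qed.

(** The first entry of a coded sequence is the number of trailing zero bits of
    its code, which an unbounded search finds. *)
Lemma rec_chead : rec1 chead.
Proof.
(* Searching in [c + (c == 0)] makes the search end at once on the empty code. *)
pose f k c : nat := odd (iter k half (c + (c == 0))) == false.
have rf : rec2 f.
  have r1 := recfun_app2 rec_add (recfun_proj (@Ordinal 2 1 isT))
    (recfun_app1 rec_eq0 (recfun_proj (@Ordinal 2 1 isT))).
  have r2 := recfun_app1 rec_eq0
   (recfun_app1 rec_odd (recfun_app2 rec_iter_half (recfun_proj ord0) r1)).
  by apply: recfun_ext r2 => v; rewrite /f; case: (odd _).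
have fE c s : c = CodeSeq.code s -> forall k, k <= head 0 s ->
    f k c = (k != head 0 s).
  move=> -> k; rewrite /f; case: s => [|a s] /=; first by case: k.
  move=> le_ka.
  have /negPf-> : 2 ^ a * (CodeSeq.code s).*2.+1 != 0 by rewrite muln_eq0 expn_eq0.
  rewrite addn0 (iter_half_ccons _ le_ka) /ccons oddM oddS odd_double andbT.
  by rewrite oddX orbF subn_eq0 eqn_leq le_ka /=; case: (a <= k).
apply: (rec_mu rf) => [b|b z lt_z].
  by rewrite (fE _ _ (esym (CodeSeq.decodeK b))) // eqxx.
by rewrite (fE _ _ (esym (CodeSeq.decodeK b))) 1?ltnW // (ltn_eqF lt_z).
Qed.

Lemma rec_ctail : rec1 ctail.
Proof.
have := recfun_app1 rec_half (recfun_app2 rec_iter_half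
  (recfun_app1 rec_chead (recfun_proj (@ord0 0))) (recfun_proj ord0)).
apply: recfun_ext => v; set c := tnth v _.
rewrite /chead /ctail -{2}[c]CodeSeq.decodeK.
case: (CodeSeq.decode c) => [|a s] //=.
by rewrite (iter_half_ccons _ (leqnn _)) subnn /ccons mul1n /= uphalf_double.
Qed.

Lemma chead_cons a b : chead (ccons a b) = a.
Proof.
rewrite /chead -[b]CodeSeq.decodeK.
by rewrite (CodeSeq.codeK (a :: CodeSeq.decode b)).
Qed.

Lemma ctail_cons a b : ctail (ccons a b) = b.
Proof.
rewrite /ctail -[b]CodeSeq.decodeK.
by rewrite (CodeSeq.codeK (a :: CodeSeq.decode b)).
Qed.

Implicit Types E S T U V : countType.

(** Types are coded by [pickle], which is the identity on [nat] and
    [CodeSeq.code] on sequences of numbers.  Nothing is asked of the program on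
    the numbers that code no element of [S]. *)
Definition computable S T (f : S -> T) :=
  exists p : mu_rec 1, forall x, eval O p [tuple pickle x] (pickle (f x)).

Lemma eval_comp1 k (p : mu_rec 1) (q : mu_rec k) v a c :
  eval O q v a -> eval O p [tuple a] c -> eval O (Comp p (fun _ : 'I_1 => q)) v c.
Proof. by move=> qa pc /=; exists [tuple a] => // i; rewrite ord1. Qed.

Lemma eval_proj k (i : 'I_k) v : eval O (Proj i) v (tnth v i).
Proof. by []. Qed.

Definition pairfun k (q r : mu_rec k) (i : 'I_2) := if i == ord0 then q else r.

Lemma eval_comp2 k (p : mu_rec 2) (q r : mu_rec k) v a b c :
  eval O q v a -> eval O r v b -> eval O p [tuple a; b] c ->
  eval O (Comp p (pairfun q r)) v c.
Proof.
move=> qa rb pc /=; exists [tuple a; b] => // i; rewrite /pairfun.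
case: eqP => [->//|/eqP i0]; rewrite (_ : i = @Ordinal 2 1 isT) //.
by case: i i0 => [[|[|i]]] // lt_i _; apply: val_inj.
Qed.

Lemma computable_ext S T (f g : S -> T) : f =1 g -> computable f -> computable g.
Proof. by move=> eqf [p pf]; exists p => x; rewrite -eqf. Qed.

Lemma computable_recode S T (f : S -> T) :
  (forall x, pickle (f x) = pickle x) -> computable f.
Proof. by move=> fE; exists (Proj ord0) => x; rewrite fE. Qed.

Lemma computable_id S : computable (fun x : S => x).
Proof. exact: computable_recode. Qed.

Lemma computable_const S T (c : T) : computable (fun _ : S => c).
Proof. by have [p pc] := recfun_const 1 (pickle c); exists p => x. Qed.

Arguments computable_const {S T} c.

Lemma computable_code S T U (h : U -> T) (f : S -> U) :
  (forall x, pickle (h x) = pickle x) -> computable f ->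
  computable (fun x => h (f x)).
Proof. by move=> hE [p pf]; exists p => x; rewrite hE. Qed.

Lemma computable_rec1 S T U (f : nat -> nat) (h : U -> T) (g : S -> U) :
  rec1 f -> (forall x, f (pickle x) = pickle (h x)) ->
  computable g -> computable (fun x => h (g x)).
Proof.
move=> [p pf] fE [q qg]; exists (Comp p (fun _ => q)) => x.
by apply: eval_comp1 (qg x) _; rewrite -fE; apply: pf.
Qed.

Lemma computable_rec2 S T U V (f : nat -> nat -> nat) (h : U -> V -> T)
    (g : S -> U) (g' : S -> V) :
  rec2 f -> (forall x y, f (pickle x) (pickle y) = pickle (h x y)) ->
  computable g -> computable g' -> computable (fun x => h (g x) (g' x)).
Proof.
move=> [p pf] fE [q qg] [r rg]; exists (Comp p (pairfun q r)) => x.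
by apply: eval_comp2 (qg x) (rg x) _; rewrite -fE; apply: pf.
Qed.

Lemma computable_oracle S (f : S -> nat) :
  computable f -> computable (fun x => O (f x)).
Proof. by apply: computable_rec1; first by exists Oracle => v; rewrite /thead. Qed.

Lemma pickle_pair S T (x : S) (y : T) :
  pickle (x, y) = ccons (pickle x) (ccons (pickle y) 0).
Proof. by []. Qed.

Lemma pickle_cons S (x : S) s : pickle (x :: s) = ccons (pickle x) (pickle s).
Proof. by []. Qed.

Lemma computable_cons S T (f : S -> T) (g : S -> seq T) :
  computable f -> computable g -> computable (fun x => f x :: g x).
Proof. exact: (computable_rec2 rec_ccons). Qed.

Lemma rec_cpair : rec2 (fun a b => ccons a (ccons b 0)).
Proof.
apply: (recfun_app2 rec_ccons (recfun_proj _)).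
exact: (recfun_app2 rec_ccons (recfun_proj _) (recfun_const _ _)).
Qed.

Lemma computable_pair S T U (f : S -> T) (g : S -> U) :
  computable f -> computable g -> computable (fun x => (f x, g x)).
Proof. exact: (computable_rec2 rec_cpair). Qed.

Lemma computable_fst S T U (f : S -> T * U) :
  computable f -> computable (fun x => (f x).1).
Proof.
apply: (computable_rec1 (h := fst) rec_chead) => -[a b].
exact: (chead_cons _ (ccons _ 0)).
Qed.

Lemma computable_snd S T U (f : S -> T * U) :
  computable f -> computable (fun x => (f x).2).
Proof.
have r := recfun_app1 rec_chead (recfun_app1 rec_ctail (recfun_proj (@ord0 0))).
apply: (computable_rec1 (h := snd) (f := fun n => chead (ctail n)) r) => -[a b].
by rewrite (ctail_cons _ (ccons _ 0)) chead_cons.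
Qed.

Lemma computable_comp S T U (f : T -> U) (g : S -> T) :
  computable f -> computable g -> computable (fun x => f (g x)).
Proof.
move=> [p pf] [q qg]; exists (Comp p (fun _ => q)) => x.
exact: eval_comp1 (qg x) (pf _).
Qed.

Lemma prim_rec_graph_sub (base base' : nat -> Prop)
    (step step' : nat -> nat -> nat -> Prop) n y :
  (forall x, base x -> base' x) ->
  (forall m z x, step m z x -> step' m z x) ->
  prim_rec_graph base step n y -> prim_rec_graph base' step' n y.
Proof.
move=> sub_base sub_step; elim: n y => [|n IHn] y /=; first exact: sub_base.
by case=> z /IHn nz /sub_step zy; exists z.
Qed.

Lemma eval_prec2 (p : mu_rec 1) (q : mu_rec 3) n b y :
  prim_rec_graph (eval O p [tuple b]) (fun m z => eval O q [tuple m; z; b]) n y ->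
  eval O (Prec p q) [tuple n; b] y.
Proof.
have E2 : behead_tuple [tuple n; b] = [tuple b] by apply: val_inj.
have E3 m z : [tuple of m :: z :: behead_tuple [tuple n; b]] = [tuple m; z; b].
  exact: val_inj.
by apply: prim_rec_graph_sub => [x|m z x]; rewrite ?E2 ?E3.
Qed.

(** [F] is a function of the context [e], the counter and the value reached,
    packed into a single argument so as to be a function of one variable. *)
Lemma computable_natrec E T (i : E -> T) (F : E * (nat * T) -> T) (n : E -> nat) :
  computable i -> computable F -> computable n ->
  computable (fun e => nat_rect (fun _ => T) (i e) (fun k z => F (e, (k, z))) (n e)).
Proof.
move=> [pi piP] [pF pFP] [pn pnP].
have [pk pkP] : rec3 (fun k z e => ccons e (ccons (ccons k (ccons z 0)) 0)).
  apply: (recfun_app2 rec_ccons (recfun_proj _)).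
  apply: (recfun_app2 rec_ccons _ (recfun_const _ _)).
  apply: (recfun_app2 rec_ccons (recfun_proj _)).
  exact: (recfun_app2 rec_ccons (recfun_proj _) (recfun_const _ _)).
exists (Comp (Prec pi (Comp pF (fun _ => pk))) (pairfun pn (Proj ord0))) => e.
apply: eval_comp2 (pnP e) (eval_proj _ _) _; apply: eval_prec2.
elim: (n e) => [|m IHm] /=; first exact: piP.
eexists; first exact: IHm.
apply: eval_comp1 (pFP _).
by have := pkP [tuple m; pickle (nat_rect _ (i e) (fun k z => F (e, (k, z))) m); pickle e];
   rewrite !pickle_pair !(tnth_nth 0).
Qed.

(** The program for [b] may diverge on what is not the code of a nonempty
    sequence.  It is therefore run as the step of a primitive recursion whose
    length is the code of [l e]: that code is 0 exactly when [l e] is empty, and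
    repeating the step is harmless because it ignores its previous value. *)
Lemma computable_match E S T (l : E -> seq S) (a : E -> T)
    (b : E * (S * seq S) -> T) :
  computable l -> computable a -> computable b ->
  computable (fun e => if l e is x :: s then b (e, (x, s)) else a e).
Proof.
move=> [pl plP] [pa paP] [pb pbP].
have [pk pkP] : rec2 (fun e l =>
    ccons e (ccons (ccons (chead l) (ccons (ctail l) 0)) 0)).
  apply: (recfun_app2 rec_ccons (recfun_proj _)).
  apply: (recfun_app2 rec_ccons _ (recfun_const _ _)).
  apply: (recfun_app2 rec_ccons (recfun_app1 rec_chead (recfun_proj _))).
  apply: (recfun_app2 rec_ccons _ (recfun_const _ _)).
  exact: recfun_app1 rec_ctail (recfun_proj _).
pose e3 : mu_rec 3 := Proj (@Ordinal 3 2 isT).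
pose q := Comp pb (fun _ : 'I_1 => Comp pk (pairfun e3 (Comp pl (fun _ => e3)))).
exists (Comp (Prec pa q) (pairfun pl (Proj ord0))) => e.
apply: eval_comp2 (plP e) (eval_proj _ _) _; apply: eval_prec2.
have qP n z x s : l e = x :: s ->
    eval O q [tuple n; z; pickle e] (pickle (b (e, (x, s)))).
  move=> le; apply: eval_comp1 (pbP _).
  have lP : eval O (Comp pl (fun _ => e3)) [tuple n; z; pickle e] (pickle (l e)).
    by apply: eval_comp1 (plP e).
  apply: eval_comp2 (eval_proj _ _) lP _.
  have := pkP [tuple pickle e; pickle (l e)]; rewrite !(tnth_nth 0) !pickle_pair.
  by rewrite [nth _ _ 1]/(pickle (l e)) le pickle_cons chead_cons ctail_cons.
rewrite -[tnth _ _]/(pickle e).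
have qiter y z m x s : l e = x :: s ->
  prim_rec_graph y (fun m z => eval O q [tuple m; z; pickle e]) m z ->
  prim_rec_graph y (fun m z => eval O q [tuple m; z; pickle e]) m.+1
    (pickle (b (e, (x, s)))).
  by move=> le yz; exists z => //; apply: qP.
case lE: (l e) => [|x s]; first exact: paP.
have: pickle (x :: s) != 0 by rewrite pickle_cons muln_eq0 expn_eq0.
case: (pickle _) => // m _.
suff [z] : exists z, prim_rec_graph (eval O pa [tuple pickle e])
  (fun m z => eval O q [tuple m; z; pickle e]) m z by apply: qiter lE.
elim: m => [|m [z mz]]; first by exists (pickle (a e)); apply: paP.
by exists (pickle (b (e, (x, s)))); apply: qiter lE mz.
Qed.

Local Ltac proj_tac := repeat lazymatch goal with
  | |- computable (fun x => (@?f x).1) => refine (computable_fst _)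
  | |- computable (fun x => (@?f x).2) => refine (computable_snd _)
  | |- computable fst => refine (computable_fst (computable_id _))
  | |- computable snd => refine (computable_snd (computable_id _))
  | |- computable (fun x => x) => refine (computable_id _)
  end.

Lemma computable_if E T (b : E -> bool) (x y : E -> T) :
  computable b -> computable x -> computable y ->
  computable (fun e => if b e then x e else y e).
Proof.
move=> cb cx cy.
have cF : computable (fun z : E * (nat * T) => x z.1).
  by apply: computable_comp cx _; proj_tac.
have cb' : computable (fun e => b e : nat) by apply: computable_code cb.
by apply: (computable_ext _ (computable_natrec cy cF cb')) => e; case: (b e).
Qed.

Lemma computable_orb E (b c : E -> bool) :
  computable b -> computable c -> computable (fun e => b e || c e).
Proof. by move=> cb; apply/(computable_if cb)/computable_const. Qed.

Lemma computable_andb E (b c : E -> bool) :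
  computable b -> computable c -> computable (fun e => b e && c e).
Proof. by move=> cb cc; apply/(computable_if cb cc)/computable_const. Qed.

Lemma computable_negb E (b : E -> bool) :
  computable b -> computable (fun e => ~~ b e).
Proof. by move=> cb; apply: (computable_if cb); apply: computable_const. Qed.

Lemma computable_add E (f g : E -> nat) :
  computable f -> computable g -> computable (fun e => f e + g e).
Proof. exact: (computable_rec2 rec_add). Qed.

Lemma computable_leq E (f g : E -> nat) :
  computable f -> computable g -> computable (fun e => f e <= g e).
Proof.
apply: (computable_rec2 (h := leq) (f := fun a b => a - b == 0)) => //.
exact: recfun_app1 rec_eq0 rec_sub.
Qed.

Lemma computable_nateq E (f g : E -> nat) :
  computable f -> computable g -> computable (fun e => f e == g e).
Proof.
move=> cf cg; have := computable_andb (computable_leq cf cg) (computable_leq cg cf).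
by apply: computable_ext => e; rewrite eqn_leq.
Qed.

Lemma computable_eq E S (f g : E -> S) :
  computable f -> computable g -> computable (fun e => f e == g e).
Proof.
move=> cf cg.
have cp h : computable h -> computable (fun e : E => pickle (h e : S) : nat).
  by apply: computable_code.
apply: (computable_ext _ (computable_nateq (cp _ cf) (cp _ cg))) => e.
exact: (inj_eq (pcan_inj (@pickleK S))).
Qed.

Lemma computable_iter E T (f : E -> T -> T) (x : E -> T) (n : E -> nat) :
  computable (fun z : E * T => f z.1 z.2) -> computable x -> computable n ->
  computable (fun e => iter (n e) (f e) (x e)).
Proof.
move=> cf cx cn.
have cF : computable (fun z : E * (nat * T) => f z.1 z.2.2).
  apply: (computable_comp cf (g := fun z : E * (nat * T) => (z.1, z.2.2))).
  by apply: computable_pair; proj_tac.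
apply: (computable_ext _ (computable_natrec cx cF cn)) => e.
by elim: (n e) => //= m ->.
Qed.

Lemma computable_behead E S (l : E -> seq S) :
  computable l -> computable (fun e => behead (l e)).
Proof.
move=> cl; have cb : computable (fun z : E * (S * seq S) => z.2.2).
  by proj_tac.
apply: (computable_ext _ (computable_match cl (computable_const [::]) cb)) => e.
by case: (l e).
Qed.

Lemma computable_head E S x0 (l : E -> seq S) :
  computable l -> computable (fun e => head x0 (l e)).
Proof.
move=> cl; have cb : computable (fun z : E * (S * seq S) => z.2.1).
  by proj_tac.
apply: (computable_ext _ (computable_match cl (computable_const x0) cb)) => e.
by case: (l e).
Qed.

Lemma size_pickle S (s : seq S) : size s <= pickle s.
Proof.
elim: s => //= x s IHs; rewrite pickle_cons (leq_trans (_ : _ <= (pickle s).+1)) //.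
by rewrite /ccons -muln2 -[(pickle s).+1]mul1n leq_mul ?expn_gt0 ?ltnS ?leq_pmulr.
Qed.

(** Consume one entry per iteration; by [size_pickle] the code of the sequence
    bounds the number of iterations that are needed. *)
Lemma computable_foldl E S T (f : E -> T -> S -> T) (x : E -> T) (l : E -> seq S) :
  computable (fun z : E * (T * S) => f z.1 z.2.1 z.2.2) ->
  computable x -> computable l ->
  computable (fun e => foldl (f e) (x e) (l e)).
Proof.
move=> cf cx cl.
pose step e (st : T * seq S) := if st.2 is y :: s then (f e st.1 y, s) else st.
have cs : computable (fun z : E * (T * seq S) => step z.1 z.2).
  have cl2 : computable (fun z : E * (T * seq S) => z.2.2).
    by proj_tac.
  apply: (computable_match (b := fun z : E * (T * seq S) * (S * seq S) =>
    (f z.1.1 z.1.2.1 z.2.1, z.2.2)) cl2).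
    by proj_tac.
  apply: computable_pair; last by proj_tac.
  apply: (computable_comp cf (g := fun z : E * (T * seq S) * (S * seq S) =>
    (z.1.1, (z.1.2.1, z.2.1)))).
  by do ?apply: computable_pair; proj_tac.
have cp : computable (fun e => pickle (l e) : nat) by apply: computable_code cl.
have := computable_fst (computable_iter cs (computable_pair cx cl) cp).
apply: computable_ext => e.
elim: (l e) (x e) (pickle _) (size_pickle (l e)) => [|y s IHs] a m.
  by move=> _; rewrite (_ : iter m _ _ = (a, [::])) //; elim: m => //= m ->.
by case: m => // m /IHs IHm; rewrite iterSr /= IHm.
Qed.

Lemma computable_rev E S (l : E -> seq S) :
  computable l -> computable (fun e => rev (l e)).
Proof.
move=> cl.
have cf : computable (fun z : E * (seq S * S) => z.2.2 :: z.2.1).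
  by apply: computable_cons; proj_tac.
apply: (computable_ext _ (computable_foldl (f := fun _ a y => y :: a) cf
  (computable_const [::]) cl)) => e.
by rewrite /rev -[catrev _ _]/(catrev (l e) [::]); elim: (l e) [::] => //= y s IHs a.
Qed.

Lemma computable_foldr E S T (f : E -> S -> T -> T) (x : E -> T) (l : E -> seq S) :
  computable (fun z : E * (S * T) => f z.1 z.2.1 z.2.2) ->
  computable x -> computable l ->
  computable (fun e => foldr (f e) (x e) (l e)).
Proof.
move=> cf cx cl.
have cf' : computable (fun z : E * (T * S) => f z.1 z.2.2 z.2.1).
  apply: (computable_comp cf (g := fun z : E * (T * S) => (z.1, (z.2.2, z.2.1)))).
  by do ?apply: computable_pair; proj_tac.
apply: (computable_ext _ (computable_foldl (f := fun e a y => f e y a) cf' cx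
  (computable_rev cl))) => e.
by rewrite foldl_rev.
Qed.

Lemma computable_fun E S T U (f : E -> S -> T) (g : U -> E) (h : U -> S) :
  computable (fun z : E * S => f z.1 z.2) -> computable g -> computable h ->
  computable (fun u => f (g u) (h u)).
Proof. by move=> cf cg ch; apply: (computable_comp cf (computable_pair cg ch)). Qed.

Lemma computable_map E S T (f : E -> S -> T) (l : E -> seq S) :
  computable (fun z : E * S => f z.1 z.2) -> computable l ->
  computable (fun e => [seq f e x | x <- l e]).
Proof.
move=> cf cl.
apply: (computable_foldr (f := fun e x a => f e x :: a)) (computable_const _) cl.
by apply: computable_cons; [apply: (computable_fun cf)|]; proj_tac.
Qed.

Lemma computable_filter E S (f : E -> S -> bool) (l : E -> seq S) :
  computable (fun z : E * S => f z.1 z.2) -> computable l ->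
  computable (fun e => [seq x <- l e | f e x]).
Proof.
move=> cf cl; have cF : computable (fun e => foldr (fun x a =>
    if f e x then x :: a else a) [::] (l e)).
  apply: (computable_foldr (f := fun e x a => if f e x then x :: a else a))
    (computable_const _) cl.
  by apply: computable_if; [apply: (computable_fun cf)|apply: computable_cons|];
    proj_tac.
by apply: (computable_ext _ cF) => e; elim: (l e) => //= x s ->.
Qed.

Lemma computable_has E S (f : E -> S -> bool) (l : E -> seq S) :
  computable (fun z : E * S => f z.1 z.2) -> computable l ->
  computable (fun e => has (f e) (l e)).
Proof.
move=> cf cl; have cF : computable (fun e => foldr (fun x a => f e x || a)
    false (l e)).
  apply: (computable_foldr (f := fun e x a => f e x || a)) (computable_const _) cl.
  by apply: computable_orb; [apply: (computable_fun cf)|]; proj_tac.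
by apply: (computable_ext _ cF) => e; elim: (l e) => //= x s ->.
Qed.

Lemma computable_all E S (f : E -> S -> bool) (l : E -> seq S) :
  computable (fun z : E * S => f z.1 z.2) -> computable l ->
  computable (fun e => all (f e) (l e)).
Proof.
move=> cf cl; have cF : computable (fun e => foldr (fun x a => f e x && a)
    true (l e)).
  apply: (computable_foldr (f := fun e x a => f e x && a)) (computable_const _) cl.
  by apply: computable_andb; [apply: (computable_fun cf)|]; proj_tac.
by apply: (computable_ext _ cF) => e; elim: (l e) => //= x s ->.
Qed.

Lemma computable_cat E S (k l : E -> seq S) :
  computable k -> computable l -> computable (fun e => k e ++ l e).
Proof.
move=> ck cl; have cF : computable (fun e => foldr cons (l e) (k e)).
  apply: (computable_foldr (f := fun _ x a => x :: a)) cl ck.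
  by apply: computable_cons; proj_tac.
by apply: (computable_ext _ cF) => e; elim: (k e) => //= x s ->.
Qed.

Lemma computable_flatten E S (l : E -> seq (seq S)) :
  computable l -> computable (fun e => flatten (l e)).
Proof.
move=> cl; apply: (computable_foldr (f := fun _ x a => x ++ a))
  (computable_const _) cl.
by apply: computable_cat; proj_tac.
Qed.

Lemma computable_size E S (l : E -> seq S) :
  computable l -> computable (fun e => size (l e)).
Proof.
move=> cl; have cF : computable (fun e => foldr (fun _ n => n + 1) 0 (l e)).
  apply: (computable_foldr (f := fun _ x a => a + 1)) (computable_const _) cl.
  by apply: computable_add; [proj_tac|apply: computable_const].
by apply: (computable_ext _ cF) => e; elim: (l e) => //= x s ->; rewrite addn1.
Qed.

Lemma computable_mem E S (x : E -> S) (l : E -> seq S) :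
  computable x -> computable l -> computable (fun e => x e \in l e).
Proof.
move=> cx cl; have cF : computable (fun e => has (fun y => y == x e) (l e)).
  apply: (computable_has (f := fun e y => y == x e)) cl.
  by apply: computable_eq; [proj_tac|apply: (computable_comp cx); proj_tac].
by apply: (computable_ext _ cF) => e; rewrite has_pred1.
Qed.

Lemma computable_drop E S (n : E -> nat) (l : E -> seq S) :
  computable n -> computable l -> computable (fun e => drop (n e) (l e)).
Proof.
move=> cn cl; have cF : computable (fun e => iter (n e) behead (l e)).
  apply: (computable_iter (f := fun _ => behead)) cl cn.
  by apply: computable_behead; proj_tac.
apply: (computable_ext _ cF) => e; elim: (n e) => [|m IHm]; first by rewrite drop0.
by rewrite iterS IHm -drop1 drop_drop add1n.
Qed.

Lemma computable_nth E S x0 (l : E -> seq S) (n : E -> nat) :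
  computable l -> computable n -> computable (fun e => nth x0 (l e) (n e)).
Proof.
move=> cl cn; apply: (computable_ext _ (computable_head x0 (computable_drop cn cl))).
by move=> e; rewrite -nth0 nth_drop addn0.
Qed.

Lemma computable_nseq E S (n : E -> nat) (x : E -> S) :
  computable n -> computable x -> computable (fun e => nseq (n e) (x e)).
Proof.
move=> cn cx.
apply: (computable_iter (f := fun e => cons (x e))) (computable_const _) cn.
by apply: computable_cons; [apply: (computable_comp cx)|]; proj_tac.
Qed.

Lemma computable_iota E (n : E -> nat) :
  computable n -> computable (fun e => iota 0 (n e)).
Proof.
move=> cn; have cF := computable_natrec (F := fun z : E * (nat * seq nat) =>
   rcons z.2.2 z.2.1) (computable_const [::]) _ cn.
apply: (computable_ext _ (cF _)) => [e|].
  elim: (n e) => // m IHm; rewrite -[in RHS]addn1 iotaD add0n cats1 -IHm.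
  by [].
apply: (@computable_ext _ _ (fun z : E * (nat * seq nat) => z.2.2 ++ [:: z.2.1])).
  by move=> z; rewrite cats1.
by apply: computable_cat; [|apply: computable_cons; [|exact: computable_const]];
   proj_tac.
Qed.

Lemma computable_decode E (f : E -> nat) :
  computable f -> computable (fun e => CodeSeq.decode (f e)).
Proof.
apply: (computable_code (h := CodeSeq.decode)) => n.
by rewrite -[RHS]CodeSeq.decodeK; congr CodeSeq.code; rewrite map_id.
Qed.

Lemma computable_CodeSeq E (f : E -> seq nat) :
  computable f -> computable (fun e => CodeSeq.code (f e)).
Proof.
apply: (computable_code (h := CodeSeq.code)) => s.
by rewrite -[pickle s]/(CodeSeq.code [seq i | i <- s]) map_id.
Qed.

End Computability.

Lemma computable_succ O (E : countType) (f : E -> nat) :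
  computable O f -> computable O (fun e => (f e).+1).
Proof. exact: (computable_rec1 (rec_succ O)). Qed.

(** Extension point of the next tactic, for functions defined later. *)
Ltac computable_extra := fail.

(** Decompose the function to be computed along its outermost operation. *)
Ltac computable_step :=
  cbv beta;
  lazymatch goal with
  | |- computable _ (fun _ => ?c) => apply: computable_const
  | |- computable _ (fun x => x) => refine (computable_id _ _)
  | |- computable _ (fun x => (@?f x).1) => refine (computable_fst _)
  | |- computable _ (fun x => (@?f x).2) => refine (computable_snd _)
  | |- computable _ (fun x => (@?f x, @?g x)) => refine (computable_pair _ _)
  | |- computable _ (fun x => (@?f x) :: (@?g x)) => refine (computable_cons _ _)
  | |- computable _ (fun x => (@?f x) ++ (@?g x)) => refine (computable_cat _ _)
  | |- computable _ (fun x => map (@?F x) (@?l x)) =>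
      refine (computable_map (f := F) _ _)
  | |- computable _ (fun x => filter (@?F x) (@?l x)) =>
      refine (computable_filter (f := F) _ _)
  | |- computable _ (fun x => has (@?F x) (@?l x)) =>
      refine (computable_has (f := F) _ _)
  | |- computable _ (fun x => all (@?F x) (@?l x)) =>
      refine (computable_all (f := F) _ _)
  | |- computable _ (fun x => iter (@?k x) (@?F x) (@?a x)) =>
      refine (computable_iter (f := F) _ _ _)
  | |- computable _ (fun x => flatten (@?l x)) => refine (computable_flatten _)
  | |- computable _ (fun x => rev (@?l x)) => refine (computable_rev _)
  | |- computable _ (fun x => size (@?l x)) => refine (computable_size _)
  | |- computable _ (fun x => head _ (@?l x)) => refine (computable_head _ _)
  | |- computable _ (fun x => behead (@?l x)) => refine (computable_behead _)
  | |- computable _ (fun x => drop (@?k x) (@?l x)) => refine (computable_drop _ _)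
  | |- computable _ (fun x => nth _ (@?l x) (@?k x)) => refine (computable_nth _ _ _)
  | |- computable _ (fun x => nseq (@?k x) (@?y x)) => refine (computable_nseq _ _)
  | |- computable _ (fun x => iota 0 (@?k x)) => refine (computable_iota _)
  | |- computable _ (fun x => (@?y x) \in (@?l x)) => refine (computable_mem _ _)
  | |- computable _ (fun x => (@?f x) == (@?g x)) => refine (computable_eq _ _)
  | |- computable _ (fun x => (@?f x) && (@?g x)) => refine (computable_andb _ _)
  | |- computable _ (fun x => (@?f x) || (@?g x)) => refine (computable_orb _ _)
  | |- computable _ (fun x => ~~ (@?f x)) => refine (computable_negb _)
  | |- computable _ (fun x => @?f x <= @?g x) => refine (computable_leq _ _)
  | |- computable _ (fun x => (@?f x).+1) => refine (computable_succ _)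
  | |- computable _ (fun x => CodeSeq.code (@?f x)) => refine (computable_CodeSeq _)
  | |- computable _ (fun x => CodeSeq.decode (@?f x)) => refine (computable_decode _)
  | |- computable (char_fun ?Q) (fun x => char_fun ?Q (@?f x)) =>
      refine (computable_oracle _)
  | |- computable _ (fun x => @?b x) =>
      first [computable_extra | refine (computable_if _ _ _)]
  | |- computable ?O ?f => change (computable O (fun x => f x))
  end.
Ltac computability := repeat computable_step.

(** * Paths in labelled graphs *)

Section Walks.
Local Open Scope group_scope.
Variables (K : groupType) (L : eqType) (lab : L -> K).
Implicit Types (T : seq (nat * L * nat)).

Inductive walk T : nat -> K -> nat -> Prop :=
| WalkNil p : walk T p 1 p
| WalkCons p k q z r :
    (p, k, q) \in T -> walk T q z r -> walk T p (lab k * z) r.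

Lemma walk1 T p k q : (p, k, q) \in T -> walk T p (lab k) q.
Proof. by move=> Tpq; rewrite -[lab k]mulg1; apply: WalkCons Tpq (WalkNil _ _). Qed.

Lemma walk_cat T p y q z r : walk T p y q -> walk T q z r -> walk T p (y * z) r.
Proof.
elim=> [{}p|{}p k q' {}y {}r' pq' _ IH] qr; first by rewrite mul1g.
by rewrite -mulgA; apply: WalkCons pq' (IH qr).
Qed.

Lemma walk_trans T T' p z q :
  (forall p k q, (p, k, q) \in T -> walk T' p (lab k) q) ->
  walk T p z q -> walk T' p z q.
Proof.
move=> sTT'; elim=> [{}p|{}p k q' {}z r pq' _ IH]; first exact: WalkNil.
exact: walk_cat (sTT' _ _ _ pq') IH.
Qed.

Lemma walk_sub T T' p z q : {subset T <= T'} -> walk T p z q -> walk T' p z q.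
Proof. by move=> sTT'; apply: walk_trans => p' k q' /sTT'; apply: walk1. Qed.

End Walks.

Section Words.
Local Open Scope group_scope.
Variables (K : groupType) (lab : nat -> K).

Definition word_val (w : seq nat) : K := \prod_(k <- w) lab k.

Lemma word_val_nil : word_val [::] = 1. Proof. exact: big_nil. Qed.

Lemma word_val_cons k w : word_val (k :: w) = lab k * word_val w.
Proof. exact: big_cons. Qed.

Lemma word_val_cat v w : word_val (v ++ w) = word_val v * word_val w.
Proof. exact: big_cat. Qed.

(** The path that reads [v] through vertices [f u] named after the suffixes [u]
    of [v] still to be read. *)
Definition suffix_steps (f : seq nat -> nat) (v : seq nat) : seq (nat * nat * nat) :=
  [seq (f (drop i v), nth 0 v i, f (drop i.+1 v)) | i <- iota 0 (size v)].

Lemma suffix_stepsP f v p k q :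
  reflect (exists u v', [/\ v = u ++ k :: v', p = f (k :: v') & q = f v'])
    ((p, k, q) \in suffix_steps f v).
Proof.
apply: (iffP mapP) => [[i]|[u [v' [-> -> ->]]]].
  rewrite mem_iota add0n => /= lt_iv [-> -> ->].
  exists (take i v), (drop i.+1 v).
  by rewrite -(drop_nth 0 lt_iv) cat_take_drop.
exists (size u); first by rewrite mem_iota size_cat /= addnS ltnS leq_addr.
by rewrite drop_size_cat // nth_cat ltnn subnn /= -cat_rcons drop_size_cat ?size_rcons.
Qed.

Lemma suffix_walk f u v T : {subset suffix_steps f (u ++ v) <= T} ->
  walk lab T (f v) (word_val v) (f [::]).
Proof.
elim: v u => [|k v IHv] u sT; first by rewrite word_val_nil; apply: WalkNil.
rewrite word_val_cons; apply: (@WalkCons _ _ _ _ _ _ (f v)).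
  by apply: sT; apply/suffix_stepsP; exists u, v.
by apply: (IHv (rcons u k)); rewrite cat_rcons.
Qed.

(** Vertex [CodeSeq.code v] means that [v] is still to be read before the next
    word of [D] can start.  The vertex 0, code of the empty word, is both
    initial and final. *)
Definition star_steps (D : seq (seq nat)) : seq (nat * nat * nat) :=
  flatten [seq suffix_steps CodeSeq.code v | v <- D] ++
  [seq (0, head 0 v, CodeSeq.code (behead v)) | v <- D & v != [::]].

Lemma star_walk D z :
  walk lab (star_steps D) 0 z 0 <->
  exists2 ws, {subset ws <= D} & z = word_val (flatten ws).
Proof.
split=> [|[ws wsD ->]]; last first.
  elim: ws wsD => [|v ws IHws] wsD; first by rewrite word_val_nil; apply: WalkNil.
  have Dv : v \in D by apply: wsD; rewrite mem_head.
  rewrite /= word_val_cat; apply: walk_cat (IHws _); last first.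
    by move=> v' wsv'; apply: wsD; rewrite inE wsv' orbT.
  case: v Dv {wsD IHws} => [|k v] Dv; first by rewrite word_val_nil; apply: WalkNil.
  rewrite word_val_cons; apply: (@WalkCons _ _ _ _ _ _ (CodeSeq.code v)).
    by rewrite mem_cat; apply/orP/or_intror/mapP; exists (k :: v);
       rewrite // mem_filter Dv.
  apply: (@suffix_walk CodeSeq.code [:: k]) => t vt.
  rewrite mem_cat; apply/orP/or_introl/flattenP.
  by exists (suffix_steps CodeSeq.code (k :: v)); first exact: map_f.
suff H p r : walk lab (star_steps D) p z r -> r = 0 -> forall v, p = CodeSeq.code v ->
    exists2 ws, {subset ws <= D} & z = word_val v * word_val (flatten ws).
  move=> w0; have [//|ws wsD ->] := H 0 0 w0 erefl [::].
  by exists ws; rewrite ?word_val_nil ?mul1g.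
have code_inj := can_inj CodeSeq.codeK.
elim=> {p z r} [p p0 v pv|p k q z r pq _ IHq r0 v pv].
  exists [::] => //; have -> : v = [::] by apply: code_inj; rewrite -pv p0.
  by rewrite word_val_nil mulg1.
move: pq; rewrite mem_cat => /orP[/flattenP[_ /mapP[u Du ->]]|/mapP[u]].
  move=> /suffix_stepsP[u1 [v' [uE pE qE]]].
  have -> : v = k :: v' by apply: code_inj; rewrite -pv.
  have [ws wsD ->] := IHq r0 v' qE.
  by exists ws; rewrite // word_val_cons mulgA.
rewrite mem_filter => /andP[u0 Du] [p0 kE qE].
have -> : v = [::] by apply: code_inj; rewrite -pv.
have [ws wsD ->] := IHq r0 _ qE; exists (u :: ws).
  by move=> u'; rewrite inE => /orP[/eqP->//|]; apply: wsD.
case: u u0 kE {Du qE} => //= k' u _ ->.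
by rewrite word_val_cons word_val_cat word_val_nil mul1g mulgA.
Qed.

Implicit Types (E : seq (nat * seq nat * nat)).

(** While the word of an edge into [q] is being read, the vertex records [q]
    and what remains of the word; [node [::] q] stands for [q] itself. *)
Definition node (v : seq nat) (q : nat) : nat := CodeSeq.code [:: CodeSeq.code v; q].

Lemma node_inj v q v' q' : node v q = node v' q' -> v = v' /\ q = q'.
Proof. by move=> /(can_inj CodeSeq.codeK)[/(can_inj CodeSeq.codeK)]. Qed.

(** A letter of value 1 starts the reading of each word, so that edges labelled
    by the empty word need no special treatment. *)
Variable k1 : nat.
Hypothesis lab1 : lab k1 = 1.

Definition expand E : seq (nat * nat * nat) :=
  flatten [seq (node [::] e.1.1, k1, node e.1.2 e.2) ::
               suffix_steps (node^~ e.2) e.1.2 | e <- E].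

Lemma expand_walk E p z q :
  walk lab (expand E) (node [::] p) z (node [::] q) <-> walk word_val E p z q.
Proof.
split=> [|w]; last first.
  elim: w => {p z q} [p|p v q z r pq _ IH]; first exact: WalkNil.
  apply: walk_cat IH; rewrite -[word_val v]mul1g -lab1.
  have sE : {subset (node [::] p, k1, node v q) :: suffix_steps (node^~ q) v
      <= expand E}.
    by move=> t vt; apply/flattenP; eexists; first exact: map_f pq.
  apply: WalkCons; first by apply: sE; apply: mem_head.
  by apply: (@suffix_walk (node^~ q) [::]) => t vt; apply: sE; rewrite inE vt orbT.
suff H a b : walk lab (expand E) a z b -> b = node [::] q -> forall v p,
    a = node v p -> exists2 y, z = word_val v * y & walk word_val E p y q.
  move=> w; have [//|//|y] := H _ _ w _ [::] p.
  by rewrite word_val_nil mul1g => ->.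
elim=> {a b z} [a aq v p' |a k b z c ab _ IH cq v p'] ap'.
  by move: ap'; rewrite aq => /node_inj[<- <-];
     exists 1; rewrite ?word_val_nil ?mulg1 //; apply: WalkNil.
move: ab => /flattenP[_ /mapP[[[p1 u] q1] E1 ->]]; rewrite inE => /orP[/eqP[aE kE bE]|].
  move: ap'; rewrite aE => /node_inj[<- <-].
  have [y -> w] := IH cq _ _ bE; exists (word_val u * y).
    by rewrite kE lab1 word_val_nil.
  exact: WalkCons E1 w.
move=> /suffix_stepsP[u1 [v' [uE aE bE]]].
move: ap'; rewrite aE => /node_inj[<- <-].
have [y -> w] := IH cq _ _ bE.
by exists y; rewrite // word_val_cons mulgA.
Qed.

End Words.

(** * Saturation of a finite set *)

Section Saturation.
Local Open Scope nat_scope.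
Variables (T : eqType) (C : seq T) (D : seq T -> T -> bool).

Definition sat_step (S : seq T) : seq T :=
  S ++ [seq e <- C | (e \notin S) && D S e].

Definition saturate (S : seq T) : seq T := iter (size C) sat_step S.

Lemma sat_step_sub S : {subset S <= sat_step S}.
Proof. by move=> e Se; rewrite mem_cat Se. Qed.

Lemma saturate_sub S : {subset S <= saturate S}.
Proof.
rewrite /saturate; elim: (size C) => //= m IHm e /IHm; exact: sat_step_sub.
Qed.

Lemma saturate_ind (P : T -> Prop) S :
  {in S, forall e, P e} ->
  (forall S' e, {in S', forall e', P e'} -> e \in C -> D S' e -> P e) ->
  {in saturate S, forall e, P e}.
Proof.
move=> PS PD; rewrite /saturate; elim: (size C) => //= m IHm e.
rewrite mem_cat mem_filter => /orP[/IHm//|/andP[/andP[_ De] Ce]].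
exact: PD De.
Qed.

(** Every round that is not stationary adds an element of [C], so [size C]
    rounds reach a set from which [D] derives nothing new in [C]. *)
Lemma saturate_closed S e : e \in C -> D (saturate S) e -> e \in saturate S.
Proof.
pose closed S := forall e, e \in C -> D S e -> e \in S.
suff H m S' : count [predC S'] C <= m -> closed (iter m sat_step S').
  exact: (H _ _ (count_size _ _)).
elim: m S' => [|m IHm] S' le_m.
  move=> e' Ce' _; apply/negPn/negP => nSe'.
  have : has [predC S'] C by apply/hasP; exists e'.
  by rewrite has_count ltnNge le_m.
have [cl|] := pselect (closed S').
  have stepE : sat_step S' = S'.
    rewrite /sat_step (_ : filter _ _ = [::]) ?cats0 //; apply/eqP.
    rewrite -[_ == _]negbK -has_filter; apply/hasPn => e' Ce'.
    by apply/negP => /andP[/negP nS' /(cl _ Ce')].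
  by rewrite (_ : iter m.+1 _ _ = S') //; elim: (m.+1) => //= k ->.
move=> /existsNP[e' /not_implyP[Ce' /not_implyP[De' /negP nSe']]].
rewrite iterSr; apply: IHm; rewrite -ltnS (leq_trans _ le_m) //.
have step_e' : e' \in sat_step S' by rewrite mem_cat mem_filter nSe' De' Ce' orbT.
rewrite -addn1 (leq_trans (_ : _ <= count [predC sat_step S'] C + count (pred1 e') C)) //.
  by rewrite leq_add2l -has_count has_pred1.
rewrite -count_predUI [X in _ + X](_ : _ = 0) ?addn0.
  apply: sub_count => e'' /= /orP[|/eqP->//].
  by apply: contra; apply: sat_step_sub.
apply/eqP; rewrite -leqn0 leqNgt -has_count; apply/hasPn => e'' _ /=.
by apply/negP => /andP[+ /eqP e'E]; rewrite e'E step_e'.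
Qed.

End Saturation.

(** * Decoding the instances of the two problems *)

Lemma subset_map_seq (S T : eqType) (f : S -> T) (s : seq S) (t : seq T) :
  {subset t <= map f s} -> exists2 u, {subset u <= s} & t = map f u.
Proof.
elim: t => [|y t IHt] ts; first by exists [::].
have [u us ->] : exists2 u, {subset u <= s} & t = map f u.
  by apply: IHt => z tz; apply: ts; rewrite inE tz orbT.
have /mapP[x sx ->] := ts y (mem_head _ _).
by exists (x :: u) => // z; rewrite inE => /orP[/eqP->|/us].
Qed.

Section Instances.
Local Open Scope group_scope.
Local Arguments CodeSeq.code : simpl never.
Variables (K : groupType) (n : nat) (s : 'I_n -> K).

(** Codes of no letter get the value 1, so that words of arbitrary numbers have
    a value. *)
Definition letter_of_code (k : nat) : K :=
  if insub k./2 is Some i then letter_val s (i, odd k) else 1.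

Local Notation wval := (word_val letter_of_code).

Lemma letter_of_codeK l : letter_of_code (code_letter l) = letter_val s l.
Proof.
case: l => i b; rewrite /letter_of_code /code_letter /= addnC half_bit_double.
by rewrite valK oddD odd_double addbF; case: b.
Qed.

Lemma word_val_code w : wval (map (@code_letter n) w) = Defs.eta s w.
Proof. by rewrite /word_val big_map; apply: eq_bigr => l _; apply: letter_of_codeK. Qed.

Definition valid_letter (k : nat) : bool := (k < n.*2)%N.
Definition valid_word (w : seq nat) : bool := all valid_letter w.

Lemma valid_letterP k : reflect (exists l : letter n, code_letter l = k) (valid_letter k).
Proof.
apply: (iffP idP) => [lt_k|[[i b] <-]].
  have lt_k2 : (k./2 < n)%N by rewrite ltn_half_double.
  by exists (Ordinal lt_k2, odd k); rewrite /code_letter /= addnC odd_double_half.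
rewrite /valid_letter /code_letter /= (leq_trans (_ : _ < i.+1.*2)%N) ?leq_double //.
by rewrite doubleS ltnS -addn1 leq_add2l; case: b.
Qed.

Lemma valid_wordP w : reflect (exists u, map (@code_letter n) u = w) (valid_word w).
Proof.
apply: (iffP allP) => [|[u <-] _ /mapP[l _ ->]]; last by apply/valid_letterP; exists l.
elim: w => [|k w IHw] vw; first by exists [::].
have /valid_letterP[l lE] := vw k (mem_head _ _).
have [|u uE] := IHw; first by move=> k' wk'; apply: vw; rewrite inE wk' orbT.
by exists (l :: u); rewrite /= lE uE.
Qed.

Lemma submonoid_membershipP (D : seq (seq (letter n))) w :
  submonoid_membership s D w <->
  exists2 ws, {subset ws <= map (map (@code_letter n)) D} &
    wval (map (@code_letter n) w) = wval (flatten ws).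
Proof.
split=> [[_ [ws wsD ->] wE]|[ws /subset_map_seq[us usD ->]]].
  exists (map (map (@code_letter n)) ws); last by rewrite -map_flatten !word_val_code.
  by move=> _ /mapP[u wsu ->]; apply/map_f/wsD.
rewrite -map_flatten !word_val_code => wE.
by exists (flatten us); [exists us|].
Qed.

Definition code_step (t : nat * letter n * nat) : nat * nat * nat :=
  (t.1.1, code_letter t.1.2, t.2).

Lemma run_walk (M : automaton n) p z q :
  walk letter_of_code (map code_step (transitions M)) p z q <->
  exists2 v, run M p v q & Defs.eta s v = z.
Proof.
split=> [|[v + <-]].
  elim=> {p z q} [p|p k q z r /mapP[[[p' l] q'] Ml [-> -> ->]] _ [v rv <-]].
    by exists [::]; rewrite // /Defs.eta big_nil.
  by exists (l :: v); [exists q'|rewrite /Defs.eta big_cons letter_of_codeK].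
elim: v p => [|l v IHv] p /=; first by move=> ->; rewrite /Defs.eta big_nil; apply: WalkNil.
case=> r Mr /IHv w; rewrite /Defs.eta big_cons -letter_of_codeK.
by apply: WalkCons w; apply: (map_f code_step Mr).
Qed.

Lemma rational_membershipP (M : automaton n) w :
  rational_membership s M w <->
  exists p q, [/\ p \in initial M, q \in final M &
    walk letter_of_code (map code_step (transitions M)) p
      (wval (map (@code_letter n) w)) q].
Proof.
rewrite word_val_code; split=> [[v [p [q [Mp Mq rv]]] vE]|[p [q [Mp Mq]]]].
  by exists p, q; split=> //; apply/run_walk; exists v.
by move=> /run_walk[v rv vE]; exists v => //; exists p, q.
Qed.

Definition field (x i : nat) : nat := nth 0%N (CodeSeq.decode x) i.
Lemma field_code l i : field (CodeSeq.code l) i = nth 0%N l i.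
Proof. by rewrite /field CodeSeq.codeK. Qed.

Definition inst_word (x : nat) : seq nat := CodeSeq.decode (field x 1).

Definition inst_gens (x : nat) : seq (seq nat) :=
  [seq CodeSeq.decode y | y <- CodeSeq.decode (field x 0)].

Definition valid_submonoid (x : nat) : bool :=
  [&& size (CodeSeq.decode x) == 2, all valid_word (inst_gens x) &
      valid_word (inst_word x)].

Lemma decode_size2 x : size (CodeSeq.decode x) = 2 ->
  x = CodeSeq.code [:: field x 0; field x 1].
Proof.
by rewrite /field; case: (CodeSeq.decode x) (CodeSeq.decodeK x) => [|a [|b []]] // <-.
Qed.

Lemma decode_size3 x : size (CodeSeq.decode x) = 3 ->
  x = CodeSeq.code [:: field x 0; field x 1; field x 2].
Proof.
by rewrite /field; case: (CodeSeq.decode x) (CodeSeq.decodeK x) =>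
  [|a [|b [|c []]]] // <-.
Qed.

Lemma submonoid_problemE x : submonoid_problem s x <->
  valid_submonoid x /\
  exists2 ws, {subset ws <= inst_gens x} & wval (inst_word x) = wval (flatten ws).
Proof.
split=> [[D [w [-> /submonoid_membershipP mem]]]|].
  have gE : inst_gens (CodeSeq.code [:: CodeSeq.code (map (@code_word n) D); code_word w])
      = map (map (@code_letter n)) D.
    rewrite /inst_gens field_code /= CodeSeq.codeK -map_comp.
    by apply: eq_map => u; apply: CodeSeq.codeK.
  have wE : inst_word (CodeSeq.code [:: CodeSeq.code (map (@code_word n) D); code_word w])
      = map (@code_letter n) w.
    by rewrite /inst_word field_code /= CodeSeq.codeK.
  split; last by rewrite gE wE.
  rewrite /valid_submonoid gE wE CodeSeq.codeK /=; apply/andP; split.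
    by apply/allP => _ /mapP[u _ ->]; apply/valid_wordP; exists u.
  by apply/valid_wordP; exists w.
case=> /and3P[/eqP/decode_size2 xE /allP vD /valid_wordP[w wE]] mem.
have [D DE] : exists D, map (map (@code_letter n)) D = inst_gens x.
  elim: (inst_gens x) vD => [|u us IHus] vus; first by exists [::].
  have /valid_wordP[v vE] := vus u (mem_head _ _).
  have [|D DE] := IHus; first by move=> u' us'; apply: vus; rewrite inE us' orbT.
  by exists (v :: D); rewrite /= vE DE.
exists D, w; split; last by apply/submonoid_membershipP; rewrite DE wE.
rewrite [LHS]xE; congr CodeSeq.code; congr [:: _; _]; last first.
  by rewrite /code_word wE CodeSeq.decodeK.
rewrite -[LHS]CodeSeq.decodeK; congr CodeSeq.code.
rewrite (eq_map (_ : @code_word n =1 CodeSeq.code \o map (@code_letter n))) //.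
rewrite map_comp DE -map_comp -[LHS]map_id; apply: eq_map => y /=.
by rewrite CodeSeq.decodeK.
Qed.

Definition inst_states (i x : nat) : seq nat := CodeSeq.decode (field (field x 0) i).
Definition inst_steps (x : nat) : seq (nat * nat * nat) :=
  [seq (field y 0, field y 1, field y 2) | y <- CodeSeq.decode (field (field x 0) 2)].

Definition valid_step (y : nat) : bool :=
  (size (CodeSeq.decode y) == 3) && valid_letter (field y 1).

Definition valid_rational (x : nat) : bool :=
  [&& size (CodeSeq.decode x) == 2, size (CodeSeq.decode (field x 0)) == 3,
      all valid_step (CodeSeq.decode (field (field x 0) 2)) &
      valid_word (inst_word x)].

Lemma rational_problemE x : rational_problem s x <->
  valid_rational x /\
  exists p q, [/\ p \in inst_states 0 x, q \in inst_states 1 x &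
    walk letter_of_code (inst_steps x) p (wval (inst_word x)) q].
Proof.
split=> [[M [w [xE /rational_membershipP mem]]]|].
  have fE : field x 0 = code_automaton M by rewrite xE field_code.
  have wE : inst_word x = map (@code_letter n) w.
    by rewrite xE /inst_word field_code /= CodeSeq.codeK.
  have stE : inst_steps x = map code_step (transitions M).
    rewrite /inst_steps fE field_code /= CodeSeq.codeK -map_comp.
    by apply: eq_map => t; rewrite /= !field_code.
  have iE : inst_states 0 x = initial M.
    by rewrite /inst_states fE field_code /= CodeSeq.codeK.
  have qE : inst_states 1 x = final M.
    by rewrite /inst_states fE field_code /= CodeSeq.codeK.
  split; last by rewrite iE qE stE wE.
  rewrite /valid_rational fE wE {1}xE !CodeSeq.codeK /=; apply/andP; split.
    rewrite field_code /= CodeSeq.codeK.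
    apply/allP => _ /mapP[t _ ->]; rewrite /valid_step field_code CodeSeq.codeK /=.
    by apply/valid_letterP; exists t.1.2.
  by apply/valid_wordP; exists w.
case=> /and4P[/eqP/decode_size2 xE /eqP/decode_size3 mE /allP vT /valid_wordP[w wE]] mem.
have [T TE] : exists T, map (@code_transition n) T =
    CodeSeq.decode (field (field x 0) 2).
  elim: (CodeSeq.decode _) vT => [|y ys IHys] vys; first by exists [::].
  have /andP[/eqP/decode_size3 yE /valid_letterP[l lE]] := vys y (mem_head _ _).
  have [|T TE] := IHys; first by move=> y' ys'; apply: vys; rewrite inE ys' orbT.
  exists ((field y 0, l, field y 2) :: T); rewrite /= TE; congr (_ :: _).
  by rewrite [RHS]yE /code_transition /= lE.
exists (Automaton (inst_states 0 x) (inst_states 1 x) T), w; split.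
  rewrite [LHS]xE; congr CodeSeq.code; congr [:: _; _]; last first.
    by rewrite /code_word wE CodeSeq.decodeK.
  rewrite [LHS]mE /code_automaton -[transitions _]/T TE CodeSeq.decodeK.
  by rewrite -[initial _]/(inst_states 0 x) -[final _]/(inst_states 1 x) !CodeSeq.decodeK.
apply/rational_membershipP; rewrite wE /=.
suff -> : map code_step T = inst_steps x by [].
rewrite /inst_steps -TE -map_comp; apply: eq_map => t.
by rewrite /= !field_code.
Qed.

Definition submonoid_code (D : seq (seq nat)) (w : seq nat) : nat :=
  CodeSeq.code [:: CodeSeq.code (map CodeSeq.code D); CodeSeq.code w].

Lemma submonoid_problem_code D w : all valid_word D -> valid_word w ->
  submonoid_problem s (submonoid_code D w) <->
  exists2 ws, {subset ws <= D} & wval w = wval (flatten ws).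
Proof.
move=> vD vw; have gE : inst_gens (submonoid_code D w) = D.
  rewrite /inst_gens field_code /= CodeSeq.codeK -map_comp -[RHS]map_id.
  by apply: eq_map => u; apply: CodeSeq.codeK.
have wE : inst_word (submonoid_code D w) = w.
  by rewrite /inst_word field_code /= CodeSeq.codeK.
rewrite submonoid_problemE gE wE; split=> [[]//|mem]; split=> //.
by rewrite /valid_submonoid gE wE vD vw CodeSeq.codeK.
Qed.

Definition rational_code (I F : seq nat) (T : seq (nat * nat * nat)) (w : seq nat) : nat :=
  CodeSeq.code [:: CodeSeq.code [:: CodeSeq.code I; CodeSeq.code F;
    CodeSeq.code [seq CodeSeq.code [:: t.1.1; t.1.2; t.2] | t <- T]]; CodeSeq.code w].

Lemma rational_problem_code I F T w :
  {in T, forall t, valid_letter t.1.2} -> valid_word w ->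
  rational_problem s (rational_code I F T w) <->
  exists p q, [/\ p \in I, q \in F & walk letter_of_code T p (wval w) q].
Proof.
move=> vT vw; set x := rational_code I F T w.
have fE i : field (field x 0) i = nth 0%N [:: CodeSeq.code I; CodeSeq.code F;
    CodeSeq.code [seq CodeSeq.code [:: t.1.1; t.1.2; t.2] | t <- T]] i.
  by rewrite /x !field_code.
have wE : inst_word x = w by rewrite /x /inst_word field_code /= CodeSeq.codeK.
have stE : inst_steps x = T.
  rewrite /inst_steps fE /= CodeSeq.codeK -map_comp -[RHS]map_id.
  by apply: eq_map => -[[p k] q]; rewrite /comp !field_code.
rewrite rational_problemE /inst_states !fE /= !CodeSeq.codeK wE stE.
split=> [[]//|mem]; split=> //; apply/and4P; split; rewrite ?wE //.
- by rewrite /x CodeSeq.codeK.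
- by rewrite /x field_code /= CodeSeq.codeK.
- rewrite fE /= CodeSeq.codeK; apply/allP => _ /mapP[t Tt ->].
  by rewrite /valid_step field_code CodeSeq.codeK /= vT.
Qed.

End Instances.

Lemma computable_field O (E : countType) (f g : E -> nat) :
  computable O f -> computable O g -> computable O (fun e => field (f e) (g e)).
Proof. by move=> cf cg; rewrite /field; computability. Qed.

Ltac computable_extra ::=
  match goal with
  | |- computable _ (fun x => field (@?f x) (@?g x)) => refine (computable_field _ _)
  | H : computable ?O ?f |- computable ?O ?f => exact: H
  | H : computable ?O ?h |- computable ?O (fun x => ?h (@?f x)) =>
      refine (computable_comp H _)
  | H : computable ?O (fun z : _ * _ => ?h z.1 z.2) |-
      computable ?O (fun x => ?h (@?f x) (@?g x)) =>
      refine (computable_fun (f := h) H _ _)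
  end.

Lemma turing_reducible_computable (P Q : set nat) (f : nat -> bool) :
  (forall x, P x <-> f x) -> computable (char_fun Q) f -> turing_reducible P Q.
Proof.
move=> Pf [p pf]; exists p => x; rewrite /char_fun.
rewrite (_ : `[< P x >] = f x); first exact: pf.
by apply/asboolP/idP => /Pf.
Qed.

Lemma char_funP (P : set nat) x : (char_fun P x == 1%N) = `[< P x >].
Proof. by rewrite /char_fun; case: asboolP. Qed.

(** * From submonoids to rational subsets *)

Lemma star_steps_label D p k q :
  (p, k, q) \in star_steps D -> exists2 v, v \in D & k \in v.
Proof.
rewrite mem_cat => /orP[/flattenP[_ /mapP[v Dv ->]]|/mapP[v]].
  move=> /suffix_stepsP[u [v' [vE _ _]]]; exists v => //.
  by rewrite vE mem_cat mem_head orbT.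
rewrite mem_filter => /andP[v0 Dv] [_ -> _]; exists v => //.
by case: v v0 {Dv} => //= l v _; rewrite mem_head.
Qed.

Lemma computable_valid_submonoid O n : computable O (valid_submonoid n).
Proof.
rewrite /valid_submonoid /inst_gens /inst_word /valid_word /valid_letter.
by computability.
Qed.

Lemma computable_valid_rational O n : computable O (valid_rational n).
Proof.
rewrite /valid_rational /valid_step /valid_word /valid_letter /inst_word.
by computability.
Qed.

Section SubmonoidToRational.
Variables (K : groupType) (n : nat) (s : 'I_n -> K).

Definition star_instance (x : nat) : nat :=
  rational_code [:: 0] [:: 0] (star_steps (inst_gens x)) (inst_word x).

Lemma star_instanceP x : valid_submonoid n x ->
  submonoid_problem s x <-> rational_problem s (star_instance x).
Proof.
move=> vx; have /and3P[_ /allP vg vw] := vx.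
rewrite rational_problem_code //; last first.
  move=> [[p k] q] /star_steps_label[v /vg/allP vv kv]; exact: vv.
rewrite submonoid_problemE.
split=> [[_ /star_walk w]|[p [q []]]]; first by exists 0, 0; rewrite !mem_head.
by rewrite !inE => /eqP-> /eqP-> /star_walk w.
Qed.

Lemma submonoid_to_rational :
  turing_reducible (submonoid_problem s) (rational_problem s).
Proof.
apply: (@turing_reducible_computable _ _ (fun x => valid_submonoid n x &&
  (char_fun (rational_problem s) (star_instance x) == 1))).
  move=> x; rewrite char_funP; split=> [Px|/andP[vx /asboolP]].
    have /submonoid_problemE[vx _] := Px.
    by rewrite vx; apply/asboolP; rewrite -star_instanceP.
  by rewrite -star_instanceP.
apply: (computable_andb (computable_valid_submonoid _ n)).
rewrite /star_instance /rational_code /star_steps /suffix_steps.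
rewrite /inst_gens /inst_word.
by computability.
Qed.

End SubmonoidToRational.
(** * Britton's lemma as an action on normal forms *)

Section HNNExtension.
Local Open Scope classical_set_scope.
Local Open Scope group_scope.

Variables (G : groupType) (A B : set G) (phi : G -> G).
Hypotheses (sgA : is_subgroup A) (sgB : is_subgroup B).
Hypothesis isoAB : is_isomorphism A B phi.

(** The letter [inr e] is t when [e] is false and t^-1 when [e] is true;
    conjugation by it maps [assoc e] onto [assoc (~~ e)] by [assoc_iso e]. *)
Definition assoc (e : bool) : set G := if e then B else A.

Definition assoc_iso (e : bool) (x : G) : G :=
  if e then xget 1 [set a | A a /\ phi a = x] else phi x.

Lemma assoc_closed e : is_subgroup (assoc e).
Proof. by case: e. Qed.

Lemma assoc1 e : assoc e 1.
Proof. by have [+ _] := assoc_closed e; rewrite inE. Qed.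

Lemma assocM e x y : assoc e x -> assoc e y -> assoc e (x * y).
Proof.
have /group_closedM clM := assoc_closed e.
by move=> ex ey; have := clM x y; rewrite !inE; apply.
Qed.

Lemma assocV e x : assoc e x -> assoc e x^-1.
Proof.
have /group_closedV clV := assoc_closed e.
by move=> ex; have := clV x; rewrite !inE; apply.
Qed.

Lemma assocMr e x y : assoc e y -> assoc e (x * y) -> assoc e x.
Proof. by move=> ey /assocM-/(_ _ (assocV ey)); rewrite mulgK. Qed.

Lemma inv_phiP b : B b -> A (assoc_iso true b) /\ phi (assoc_iso true b) = b.
Proof.
have [[_ _ surj] _] := isoAB.
move=> /surj[a Aa <-]; exact: (@xgetPex _ 1 [set x | A x /\ phi x = phi a]
  (ex_intro _ a (conj Aa erefl))).
Qed.

Lemma assoc_isoP e x : assoc e x -> assoc (~~ e) (assoc_iso e x).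
Proof.
have [[phiAB _ _] _] := isoAB.
by case: e => /= [/inv_phiP[]|/phiAB].
Qed.

Lemma assoc_isoK e x : assoc e x -> assoc_iso (~~ e) (assoc_iso e x) = x.
Proof.
have [[phiAB inj _] _] := isoAB.
case: e => /= [/inv_phiP[]//|Ax]; have [Ay yx] := inv_phiP (phiAB _ Ax).
by apply: inj; rewrite ?inE.
Qed.

Lemma assoc_isoNP e x : assoc (~~ e) x -> assoc e (assoc_iso (~~ e) x).
Proof. by move=> /assoc_isoP; rewrite negbK. Qed.

Lemma assoc_isoNK e x : assoc (~~ e) x -> assoc_iso e (assoc_iso (~~ e) x) = x.
Proof. by move=> /assoc_isoK; rewrite negbK. Qed.

Lemma assoc_isoM e x y : assoc e x -> assoc e y ->
  assoc_iso e (x * y) = assoc_iso e x * assoc_iso e y.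
Proof.
have [_ morph] := isoAB.
have phiM a b : A a -> A b -> phi (a * b) = phi a * phi b.
  by move=> Aa Ab; apply: morph; rewrite inE.
case: e => [|]; last exact: phiM.
move=> Bx By; have [Ax phix] := inv_phiP Bx; have [Ay phiy] := inv_phiP By.
rewrite -{1}phix -{1}phiy -phiM //.
exact: (@assoc_isoK false _ (@assocM false _ _ Ax Ay)).
Qed.

Lemma assoc_iso1 e : assoc_iso e 1 = 1.
Proof.
have := assoc_isoM (assoc1 e) (assoc1 e); rewrite mulg1 => /eqP.
by rewrite -[X in X == _]mulg1 (inj_eq (mulgI _)) => /eqP.
Qed.

(** Representatives of the left cosets of [assoc e].  The subgroup itself is
    represented by 1, which lets [wf] recognize a letter t^e that could have
    been cancelled. *)
Definition rep e x : G :=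
  if `[< assoc e x >] then 1 else xget 1 [set y | assoc e (y^-1 * x)].

Lemma rep_coset e x : assoc e ((rep e x)^-1 * x).
Proof.
rewrite /rep; case: asboolP => [|_]; first by rewrite invg1 mul1g.
apply: (@xgetPex _ 1 [set y | assoc e (y^-1 * x)]).
by exists x => /=; rewrite mulVg; apply: assoc1.
Qed.

Lemma repM e x a : assoc e a -> rep e (x * a) = rep e x.
Proof.
move=> ea; have eM y : assoc e (y * a) <-> assoc e y.
  by split=> [|ey]; [apply: assocMr|apply: assocM].
rewrite /rep (asbool_equiv_eq (eM x)); congr (if _ then _ else xget _ _).
by apply/seteqP; split=> y /=; rewrite mulgA eM.
Qed.

Lemma repK e x : rep e (rep e x) = rep e x.
Proof.
rewrite -[in RHS](mulVKg (rep e x) x) -[RHS](repM _ (assocV (rep_coset e x))).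
by rewrite mulgK.
Qed.

(** The pair of [:: (r_k, e_k); ...; (r_1, e_1)] and [x] stands for the element
    r_1 t^e_1 ... r_k t^e_k x, where t^e abbreviates the letter [inr e].  The last
    letter comes first, because words act on the right. *)
Definition nform : Type := seq (G * bool) * G.

Definition cancels e (st : nform) : bool :=
  if st.1 is (_, e') :: _ then (e' == ~~ e) && `[< assoc e st.2 >] else false.

(** Write the last factor as r a with r a representative and a in [assoc e].
    Then r a t^e = r t^e [assoc_iso e a], unless t^e cancels against the
    preceding letter. *)
Definition act_t e (st : nform) : nform :=
  if cancels e st then
    (behead st.1, (head (1, e) st.1).1 * assoc_iso e st.2)
  else ((rep e st.2, e) :: st.1, assoc_iso e ((rep e st.2)^-1 * st.2)).

Definition act1 (st : nform) (l : G + bool) : nform :=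
  match l with inl x => (st.1, st.2 * x) | inr e => act_t e st end.

Definition act (st : nform) (u : hnn_word G) : nform := foldl act1 st u.

Fixpoint wf (s : seq (G * bool)) : Prop :=
  if s is (r, e) :: s' then
    [/\ rep e r = r, ~~ cancels e (s', r) & wf s']
  else True.

Lemma act_t_wf e st : wf st.1 -> wf (act_t e st).1.
Proof.
rewrite /act_t; case: ifP => [|/negbT].
  by case: st => [[|[r e'] s] x] //= _ [].
case: st => s x /= cx ws; split=> //; first exact: repK.
case: s cx {ws} => [|[r e1] s] /=; rewrite /cancels /= => //.
apply: contra => /andP[-> /asboolP erx].
apply/asboolP; rewrite -[x](mulVKg (rep e x)).
by apply: assocM erx (rep_coset _ _).
Qed.

(** This single computation gives both relations that involve t: the defining
    one, and at [a = 1] the fact that [inr e] and [inr (~~ e)] are inverse. *)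
Lemma act_t_conj e a st : wf st.1 -> assoc e a ->
  act_t e (act1 (act_t (~~ e) st) (inl a)) = act1 st (inl (assoc_iso e a)).
Proof.
case: st => s x /= ws ea; rewrite /act1 [act_t (~~ e) _]/act_t; case: ifP => [|_] /=.
  rewrite /cancels; case: s ws => [|[r e'] s] //= [rr cr ws].
  rewrite negbK => /andP[/eqP e'E /asboolP ex]; subst e'.
  have eb : assoc e (assoc_iso (~~ e) x * a).
    by apply: assocM => //; apply: assoc_isoNP.
  rewrite /act_t -mulgA; set b := _ * a in eb *.
  have -> : cancels e (s, r * b) = false.
    apply: contraNF cr; rewrite /cancels.
    case: s {ws} => [|[r' e'] s] //= /andP[-> /asboolP erb].
    exact/asboolP/(assocMr eb).
  rewrite /= (repM _ eb) rr mulKg /b assoc_isoM //; last first.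
    exact: assoc_isoNP.
  by rewrite assoc_isoNK.
set c := (rep _ x)^-1 * x.
have ec : assoc (~~ e) c by apply: rep_coset.
have eic : assoc e (assoc_iso (~~ e) c) by apply: assoc_isoNP.
rewrite /act_t /cancels /= eqxx asboolT /=; last exact: assocM.
rewrite assoc_isoM // assoc_isoNK //.
by rewrite mulgA /c mulVKg.
Qed.

Lemma act_cat st u v : act st (u ++ v) = act (act st u) v.
Proof. exact: foldl_cat. Qed.

Lemma act_wf st u : wf st.1 -> wf (act st u).1.
Proof.
by elim: u st => //= -[x|e] u IHu st ws; apply: IHu => //=; apply: act_t_wf.
Qed.

Lemma act_cong u v st : hnn_cong A phi u v -> wf st.1 -> act st u = act st v.
Proof.
move=> uv; elim: uv st => {u v} //=.
- by move=> u v _ IH st ws; rewrite IH.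
- by move=> u v w _ IH1 _ IH2 st ws; rewrite IH1 ?IH2.
- move=> u u' v v' _ IH1 _ IH2 st ws; rewrite !act_cat IH1 // IH2 //.
  exact: act_wf.
- by case=> s x ws; rewrite /act1 /= mulg1.
- by move=> x y [s z] ws; rewrite /act1 /= mulgA.
- move=> b st ws; have := act_t_conj ws (assoc1 (~~ b)).
  rewrite assoc_iso1 negbK /= mulg1.
  by case: (act_t b st) => s x /=; rewrite mulg1 => ->; case: st {ws}.
- by move=> a Aa st ws; apply: (@act_t_conj false).
Qed.

Local Notation K := (hnn A phi).

(** The action of [z] on the empty normal form is well defined by [act_cong],
    and multiplying by a letter changes it in the way that [act1] says. *)
Definition nf (z : K) : nform := act ([::], 1) (repr z).

Lemma nf_pi u : nf (hnn_pi A phi u) = act ([::], 1) u.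
Proof. by apply: act_cong => //; apply/hnn_piP; rewrite hnn_piK. Qed.

Lemma nf1 : nf 1 = ([::], 1).
Proof. exact: (nf_pi [::]). Qed.

Lemma nf_letter z l : nf (z * hnn_pi A phi [:: l]) = act1 (nf z) l.
Proof.
by rewrite -{1}[z]hnn_piK -[_ * _]hnn_pi_cat nf_pi act_cat.
Qed.

Definition base (x : G) : K := hnn_pi A phi [:: inl x].
Definition stable (e : bool) : K := hnn_pi A phi [:: inr e].

Lemma nf_base z x : nf (z * base x) = ((nf z).1, (nf z).2 * x).
Proof. exact: nf_letter. Qed.

Lemma nf_stable z e : nf (z * stable e) = act_t e (nf z).
Proof. exact: nf_letter. Qed.

Lemma baseM x y : base (x * y) = base x * base y.
Proof. by rewrite -[RHS]hnn_pi_cat; apply/hnn_piP/HnnSym/HnnMul. Qed.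

Lemma base1 : base 1 = 1.
Proof. exact/hnn_piP/HnnOne. Qed.

Lemma baseV x : base x^-1 = (base x)^-1.
Proof. by apply: (mulgI (base x)); rewrite -baseM !mulgV base1. Qed.

Lemma stableV e : stable (~~ e) = (stable e)^-1.
Proof.
apply: (mulgI (stable e)); rewrite mulgV -[LHS]hnn_pi_cat.
exact/hnn_piP/HnnCancel.
Qed.

Lemma stable_conj e x : assoc e x ->
  stable (~~ e) * base x * stable e = base (assoc_iso e x).
Proof.
have conjA a : A a -> stable true * base a * stable false = base (phi a).
  move=> Aa; rewrite -[stable true * _]hnn_pi_cat -[_ * stable false]hnn_pi_cat.
  exact/hnn_piP/HnnConj.
case: e => [Bx|]; last exact: conjA.
move: (assoc_iso true x) (inv_phiP Bx) => y [Ay <-].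
have tV : stable true = (stable false)^-1 := stableV false.
by rewrite -conjA // tV !mulgA mulgV mul1g mulgK.
Qed.

(** * A free product inside the HNN extension *)

(** The normal form of [z] ends with the letter t^e, up to an element that can
    be moved across it. *)
Definition ends e (z : K) : Prop :=
  exists r s x, nf z = ((r, e) :: s, x) /\ assoc (~~ e) x.

Lemma ends_push z d x :
  ~~ cancels d (nf (z * base x)) -> ends d (z * base x * stable d).
Proof.
move=> nc; rewrite /ends nf_stable /act_t (negPf nc).
by do 3!eexists; split; [by []|apply: assoc_isoP; apply: rep_coset].
Qed.

(** Britton's lemma: without a factor t^e x t^-e with [x] in the appropriate
    subgroup, no letter ever cancels. *)
Lemma ends_step z e x d :
  ends e z -> (d = ~~ e -> ~ assoc d x) -> ends d (z * base x * stable d).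
Proof.
case=> r [s [y [zE ey]]] dx; apply: ends_push.
rewrite nf_base zE /cancels /=; apply/negP => /andP[/eqP eE /asboolP dyx].
have dE : d = ~~ e by rewrite eE negbK.
apply: (dx dE); rewrite -(mulKg y x) dE; apply: assocM; first exact: assocV.
by rewrite -dE.
Qed.

Lemma ends_exp z e k : ends e z -> ends e (z * stable e ^+ k).
Proof.
elim: k => [|k IHk] ze; first by rewrite mulg1.
rewrite expgSr mulgA -[z * _]mulg1 -base1; apply: (ends_step (IHk ze)).
by case: (e) => /=.
Qed.

Lemma ends_neq1 z e : ends e z -> z <> 1.
Proof. by move=> [r [s [x [zE _]]]] z1; rewrite z1 nf1 in zE. Qed.

Section FreeProduct.
Variables (e : bool) (g h : G).
Hypotheses (Ah : ~ A h) (Bh : ~ B h).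
Hypothesis eg : e -> ~ A g.
Hypothesis gP : forall a, A a -> a <> 1 -> ~ assoc (~~ e) (g^-1 * a * g).

(* [d] is kept abstract so that rewriting rules for products do not unfold it. *)
Local Notation u := (stable e).
Variable d : K.
Hypothesis dE : d = u * base g^-1 * stable false.

(** Conjugation by [d] turns a nontrivial [x] of G into
    u (g^-1 (t x t^-1) g) u^-1.  If [x] is not in [B], no letter cancels there; for
    the factor u g^-1 t this is [eg].  If [x] is in [B], then t x t^-1 is a
    nontrivial element of [A], whose conjugate by [g] is outside [assoc (~~ e)] by
    [gP].  Either way the outer letters u and u^-1 survive.  The powers of u
    around [h] then tell the markers apart: two distinct ones leave h^-1 u^k h
    between them, with k nonzero, and nothing cancels as [h] lies outside A
    and B. *)
Definition marker (p : nat) : K := u ^+ p.+1 * base h * u ^+ p.+1 * d.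

Definition edge : Type := nat * G * nat.
Definition edge_val (t : edge) : K :=
  marker t.1.1 * base t.1.2 * (marker t.2)^-1.
Definition edges_val (L : seq edge) : K := \prod_(t <- L) edge_val t.
Definition trivial (t : edge) : Prop := t.1.1 = t.2 /\ t.1.2 = 1.

Lemma assocVN b x : ~ assoc b x -> ~ assoc b x^-1.
Proof. by move=> bx /assocV; rewrite invgK. Qed.

Lemma hN b : ~ assoc b h. Proof. by case: b. Qed.

Lemma dV : d^-1 = stable true * base g * stable (~~ e).
Proof.
by rewrite dE !invgM -!baseV invgK -(stableV false) -stableV mulgA.
Qed.

Lemma markerV q :
  (marker q)^-1 = d^-1 * u^-1 ^+ q.+1 * base h^-1 * u^-1 ^+ q.+1.
Proof.
have invM4 (x y z : K) : (x * y * x * z)^-1 = z^-1 * x^-1 * y^-1 * x^-1.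
  by rewrite !invgM !mulgA.
by rewrite /marker invM4 expVgn baseV.
Qed.

Lemma uV k : u^-1 ^+ k = stable (~~ e) ^+ k.
Proof. by rewrite stableV. Qed.

Lemma exp_cancel q p : u^-1 ^+ q.+1 * u ^+ p.+1 =
  if q < p then u ^+ (p - q) else u^-1 ^+ (q - p).
Proof.
case: ltnP => [lt_qp|le_pq].
  by rewrite -subSS expgnFr 1?ltnW // expVgn (commuteV (commuteX2 _ _ (commute_refl u))).
by rewrite -subSS expgnFr // [u^-1 ^+ p.+1]expVgn invgK.
Qed.

Lemma ends_hexp z e1 k b x : ends e1 z -> (forall b, ~ assoc b x) ->
  ends b (z * base x * stable b ^+ k.+1).
Proof.
by move=> ze xN; rewrite expgS mulgA; apply/ends_exp/(ends_step ze) => _.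
Qed.

Lemma ends_junction z e1 p q : ends e1 z -> p <> q ->
  exists e2, ends e2 (z * base h^-1 * u^-1 ^+ q.+1 * u ^+ p.+1).
Proof.
move=> ze pq; rewrite -mulgA exp_cancel.
have hVN b : ~ assoc b h^-1 by apply/assocVN/hN.
case: ltnP => [lt_qp|le_pq].
  by exists e; rewrite -(subnSK lt_qp); apply: ends_hexp ze _.
exists (~~ e); rewrite uV; have lt_pq : p < q.
  by rewrite ltn_neqAle le_pq andbT; apply/eqP.
by rewrite -(subnSK lt_pq); apply: ends_hexp ze _.
Qed.

(** The product of a prefix with one more edge again has the shape
    z' h^-1 u^-(q+1), where z' ends with t or t^-1.  Only the last power of u,
    which belongs to the marker of [q], is exposed to the next edge. *)
Lemma ends_block z e1 p x q : ends e1 z -> ~ trivial (p, x, q) ->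
  exists e2 z', ends e2 z' /\
    z * base h * u ^+ p.+1 * d * base x * (marker q)^-1 =
    z' * base h^-1 * u^-1 ^+ q.+1.
Proof.
move=> ze nt; rewrite markerV.
set y := z * base h * u ^+ p.+1.
have yu : ends e y by apply: ends_hexp ze _; apply: hN.
have [x1|x1] := pselect (x = 1).
  rewrite x1 base1 mulg1.
  have pq : p <> q by move=> pq; apply: nt.
  have [e2 ze2] : exists e2, ends e2 (y * u^-1 ^+ q.+1).
    rewrite /y -mulgA.
    have -> : u ^+ p.+1 * u^-1 ^+ q.+1 = u^-1 ^+ q.+1 * u ^+ p.+1.
      by rewrite expVgn (commuteV (commuteX2 _ _ (commute_refl u))).
    rewrite exp_cancel; case: ltnP => [lt_qp|le_pq].
      by exists e; rewrite -(subnSK lt_qp); apply: ends_hexp ze hN.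
    exists (~~ e); rewrite uV; have lt_pq : p < q.
      by rewrite ltn_neqAle le_pq andbT; apply/eqP.
    by rewrite -(subnSK lt_pq); apply: ends_hexp ze hN.
  by exists e2, (y * u^-1 ^+ q.+1); split=> //; rewrite !mulgA mulgK.
have yu2 : ends e (y * u) by rewrite -[u]expg1; apply: ends_exp.
suff zd : ends (~~ e) (y * d * base x * d^-1).
  exists (~~ e), (y * d * base x * d^-1 * u^-1 ^+ q.+1).
  by split; [rewrite uV; apply: ends_exp|rewrite !mulgA].
(* If [x] is in [B], then [t x t^-1] is a nontrivial [a] in [A], and
   [gP] prevents the letters around [a ^ g] from cancelling. *)
have [Bx|Bx] := pselect (B x).
  have /(@assoc_isoP true) /= Ay := Bx.
  set a := assoc_iso true x in Ay.
  have a1 : a <> 1.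
    move=> a1; apply: x1; rewrite -(@assoc_isoK true x Bx) -/a a1.
    exact: (assoc_iso1 false).
  have -> : y * d * base x * d^-1 = y * u * base (g^-1 * a * g) * stable (~~ e).
    rewrite dV dE !baseM -(stable_conj (e := true) Bx) /= !mulgA.
    by [].
  by apply: ends_step yu2 _ => _; apply: gP.
have yd : ends false (y * d).
  rewrite dE !mulgA; apply: ends_step yu2 _ => eE.
  by apply: (@assocVN false); apply: eg; case: (e) eE.
rewrite dV !mulgA.
have yx : ends true (y * d * base x * stable true) by apply: ends_step yd _.
by apply: ends_step yx _; case: (e) eg => // H _; apply: H.
Qed.

Fixpoint reduced_from (q : nat) (L : seq edge) : Prop :=
  if L is t :: L' then
    [/\ t.1.1 <> q, ~ trivial t & reduced_from t.2 L']
  else True.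

(** No two consecutive edges meet and none is trivial, so that some of each
    marker survives in the product. *)
Definition reduced (L : seq edge) : Prop :=
  if L is t :: L' then ~ trivial t /\ reduced_from t.2 L' else True.

Lemma reduced_from_neq1 L z e1 q : ends e1 z -> reduced_from q L ->
  z * base h^-1 * u^-1 ^+ q.+1 * edges_val L <> 1.
Proof.
elim: L z e1 q => [|[[p x] p'] L IHL] z e1 q ze /=.
  move=> _; rewrite /edges_val big_nil mulg1 uV; apply: (@ends_neq1 _ (~~ e)).
  by apply: (ends_hexp _ _ ze) => b; apply/assocVN/hN.
case=> pq nt redL; have [e2 ze2] := ends_junction ze pq.
have [e3 [z' [ze3 zE]]] := ends_block ze2 nt.
have := IHL _ _ _ ze3 redL; rewrite -zE /edges_val big_cons /edge_val /=.
by rewrite [in X in _ -> X](_ : marker p = u ^+ p.+1 * base h * u ^+ p.+1 * d) // !mulgA.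
Qed.

Lemma reduced_neq1 L : reduced L -> edges_val L = 1 -> L = [::].
Proof.
case: L => [|[[p x] q] L] //= [nt redL].
have up : ends e (u ^+ p.+1).
  rewrite expgS; apply: ends_exp.
  have := @ends_push 1 e 1; rewrite base1 mulg1 mul1g; apply.
  by rewrite nf1.
have [e3 [z' [ze3 zE]]] := ends_block up nt.
move=> prod1; case: (reduced_from_neq1 ze3 redL); rewrite -zE.
by apply: etrans _ prod1; rewrite /edges_val big_cons /edge_val /marker.
Qed.

Lemma reduced_tail q L : reduced_from q L -> reduced L.
Proof. by case: L => //= t L []. Qed.

Lemma edges_val_cons t L : edges_val (t :: L) = edge_val t * edges_val L.
Proof. exact: big_cons. Qed.

Lemma edge_val_trivial t : trivial t -> edge_val t = 1.
Proof. by case: t => [[p x] q] [/= -> ->]; rewrite /edge_val base1 mulg1 mulgV. Qed.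

Lemma edge_valM p x q y r :
  edge_val (p, x, q) * edge_val (q, y, r) = edge_val (p, x * y, r).
Proof.
rewrite /edge_val /= baseM; move: (marker p) (marker q) (marker r) => mp mq mr.
by rewrite !mulgA mulgVK.
Qed.

Lemma edge_valV p x q : (edge_val (p, x, q))^-1 = edge_val (q, x^-1, p).
Proof.
rewrite /edge_val /= baseV; move: (marker p) (marker q) => mp mq.
by rewrite !invgM invgK mulgA.
Qed.

Variable P : edge -> Prop.
Hypothesis PM : forall p x q y r, P (p, x, q) -> P (q, y, r) -> P (p, x * y, r).

(** Composing edges that meet and dropping trivial ones shortens the product
    without leaving a set [P] closed under composition. *)
Lemma reduce_edges L : {in L, forall t, P t} ->
  exists L', [/\ {in L', forall t, P t}, reduced L' & edges_val L' = edges_val L].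
Proof.
elim: L => [|t L IHL] PL; first by exists [::].
have [L1 [PL1 redL1 valL1]] : exists L', [/\ {in L', forall t, P t}, reduced L' &
    edges_val L' = edges_val L].
  by apply: IHL => t' Lt'; apply: PL; rewrite inE Lt' orbT.
rewrite edges_val_cons -valL1.
have {IHL PL valL1 L} : P t by apply: PL; rewrite mem_head.
elim: L1 t PL1 redL1 => [|t1 L1 IHL] t PL1 redL1 Pt.
  have [tt|nt] := pselect (trivial t).
    by exists [::]; split=> //; rewrite (edge_val_trivial tt) mul1g.
  exists [:: t]; split=> //; last by rewrite edges_val_cons.
  by move=> t'; rewrite inE => /eqP->.
have [tt|nt] := pselect (trivial t).
  by exists (t1 :: L1); split=> //; rewrite (edge_val_trivial tt) mul1g.
case: redL1 => nt1 redL1.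
have [eq_t|ne_t] := pselect (t1.1.1 = t.2); last first.
  exists [:: t, t1 & L1]; split=> //; last by rewrite [LHS]edges_val_cons.
  by move=> t'; rewrite inE => /orP[/eqP->//|]; apply: PL1.
case: t t1 eq_t Pt PL1 nt nt1 redL1 => [[p x] q] [[p1 y] r] /= -> Pt PL1 nt nt1 redL1.
have [|||L2 [PL2 redL2 valL2]] := IHL (p, x * y, r).
- by move=> t' L't'; apply: PL1; rewrite inE L't' orbT.
- exact: reduced_tail redL1.
- by apply: PM Pt _; apply: PL1; rewrite mem_head.
by exists L2; split=> //; rewrite valL2 edges_val_cons mulgA edge_valM.
Qed.

(** Reduce the product, then multiply it on the left by the inverse of the edge
    [t]: the result has value 1, so it is not reduced, which is only possible
    if [t] is trivial or the reduced product is [t] alone. *)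
Lemma edge_of_product L t : {in L, forall t', P t'} ->
  edges_val L = edge_val t -> P t \/ trivial t.
Proof.
case/reduce_edges => L' [PL' redL' <-] {L}; case: t => [[p x] q] valL.
have [tt|nt] := pselect (trivial (p, x, q)); [by right|left].
have nV : ~ trivial (q, x^-1, p).
  case=> /= qp xV; apply: nt; split=> //=.
  by apply/eqP; rewrite -invg_eq1 xV.
have val1 : edges_val ((q, x^-1, p) :: L') = 1.
  by rewrite edges_val_cons valL -edge_valV mulVg.
case: L' PL' redL' valL val1 => [|[[p1 x1] q1] L1] PL' redL' valL val1.
  by have := @reduced_neq1 [:: (q, x^-1, p)] (conj nV I) val1.
have [p1p|np] := pselect (p1 = p); last first.
  case: redL' => nt1 redL1.
  have := @reduced_neq1 [:: (q, x^-1, p), (p1, x1, q1) & L1] (conj nV (And3 np nt1 redL1)).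
  by move=> /(_ val1).
subst p1; move: val1; rewrite !edges_val_cons mulgA edge_valM -edges_val_cons => val1.
have [[/= qq1 xx1]|nt1] := pselect (trivial (q, x^-1 * x1, q1)).
  have -> : x = x1 by apply/eqP; rewrite eq_sym -(inj_eq (mulgI x^-1)) xx1 mulVg.
  by rewrite qq1; apply: PL'; rewrite mem_head.
case: redL' => _ redL1.
by have := @reduced_neq1 ((q, x^-1 * x1, q1) :: L1) (conj nt1 redL1) val1.
Qed.

End FreeProduct.

Variables (n : nat) (gen : 'I_n -> K).
Hypothesis gens : generates gen.

Local Notation O := (char_fun (submonoid_problem gen)).
Local Notation wval := (word_val (letter_of_code gen)).

Lemma word_of (z : K) : exists w, valid_word n w /\ wval w = z.
Proof.
have [w <-] := gens z; exists (map (@code_letter n) w).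
by split; [apply/valid_wordP; exists w|rewrite word_val_code].
Qed.

Hypothesis finB : finite_set B.
Hypothesis exg : exists g : G,
  conj_set A g `&` A = [set 1] \/ conj_set A g `&` B = [set 1].

(** * Using the condition on conjugates *)

(** If [B] were G, then [assoc_iso true] would be an injection of the finite
    group G into its proper subgroup [A]. *)
Lemma properB : (exists x, ~ A x) -> exists x, ~ B x.
Proof.
case=> x Ax; apply/existsNP => allB; apply: Ax.
have /finite_seqP[t tE] := finB.
have st : {subset map (assoc_iso true) (undup t) <= undup t}.
  by move=> y _; rewrite mem_undup; have := allB y; rewrite tE.
have ut : uniq (map (assoc_iso true) (undup t)).
  rewrite map_inj_uniq ?undup_uniq // => y z yz.
  by rewrite -(assoc_isoK (e := true) (allB y)) yz assoc_isoK //; apply: allB.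
have [|_ eqt] := uniq_min_size ut st; first by rewrite size_map.
have tx : x \in undup t by rewrite mem_undup; have := allB x; rewrite tE.
move: tx; rewrite -eqt => /mapP[y _ ->]; apply: (@assoc_isoP true); exact: allB.
Qed.

(** If [x] is in [B] and [y] in [A], then [x * y] is in neither. *)
Lemma not_union x y : ~ A x -> ~ B y -> exists h, ~ A h /\ ~ B h.
Proof.
move=> Ax By; have [Bx|] := pselect (B x); last by exists x.
have [Ay|] := pselect (A y); last by exists y.
exists (x * y); split=> [/(@assocMr false _ _ Ay)//|Bxy].
apply: By; rewrite -[y](mulKg x).
by apply: (@assocM true) => //; apply: (@assocV true).
Qed.

(** If [g^-1 A g] meets [A] trivially then [e] is true, that is, u = t^-1; if it
    meets [B] trivially then u = t.  When A = 1 any nontrivial element can serve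
    both as [g] and as [h]. *)
Lemma free_or_trivial :
  (exists (e : bool) (g h : G), [/\ ~ A h, ~ B h, e -> ~ A g &
     forall a, A a -> a <> 1 -> ~ assoc (~~ e) (g^-1 * a * g)]) \/
  (forall x : G, x = 1).
Proof.
have [A1|] := pselect (forall a, A a -> a = 1).
  have [[x x1]|] := pselect (exists x : G, x <> 1); last first.
    by move=> /forallNP all1; right=> x; apply: contrapT; apply: all1.
  left; exists true, x, x; split=> // [/A1//||_ /A1//|a /A1//].
  move=> Bx; have /A1 := @assoc_isoP true _ Bx => ix; apply: x1.
  by rewrite -(@assoc_isoK true x Bx) ix; apply: (assoc_iso1 false).
move=> /existsNP[a /not_implyP[Aa a1]]; left.
have conjP (C : set G) g b : conj_set A g `&` C = [set 1] -> A b ->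
    C (g^-1 * b * g) -> b = 1.
  move=> CE Ab Cb; apply/eqP; rewrite -(conjg_eq1 _ g); apply/eqP.
  suff : [set 1] (b ^ g) by [].
  by rewrite -CE; split; [exists b|rewrite /= conjgE mulgA].
have [g [CE|CE]] := exg.
  have Ag : ~ A g.
    move=> Ag; apply: a1; apply: (conjP A g) => //.
    by do !apply: (@assocM false) => //; apply: (@assocV false).
  have [y By] : exists y, ~ B y by apply: properB; exists g.
  have [h [Ah Bh]] := not_union Ag By.
  by exists true, g, h; split=> // b Ab b1 Ab'; apply/b1/(conjP A g).
have [x Ax] : exists x, ~ A x.
  apply/existsNP => allA; apply: a1.
  have /eqP : assoc_iso false a ^ g^-1 = 1.
    apply: (conjP B g _ CE (allA _)).
    by rewrite -mulgA -conjgE conjgKV; apply: (@assoc_isoP false).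
  rewrite conjg_eq1 => /eqP phi1.
  by rewrite -(@assoc_isoK false a Aa) phi1; apply: (assoc_iso1 true).
have [y By] : exists y, ~ B y by apply: properB; exists x.
have [h [Ah Bh]] := not_union Ax By.
by exists false, g, h; split=> // b Ab b1 Bb; apply/b1/(conjP B g).
Qed.

(** * Saturated sets of edges *)

Section Alphabet.
Variable X : seq (G + bool).

Definition lab (k : nat) : K := hnn_pi A phi [:: nth (inl 1) X k].

Definition in_base (k : nat) : bool := if nth (inl 1) X k is inl _ then true else false.

Definition step : Type := nat * nat * nat.
HB.instance Definition _ := Countable.on step.
Implicit Types (S T : seq step) (t : step).

Definition base_steps S : seq step := [seq t <- S | in_base t.1.2].

Lemma nth_inr_size k e : nth (inl 1) X k = inr e -> k < size X.
Proof. by case: ltnP => // /(nth_default (inl 1))->. Qed.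

Section Reach.
Variables (S : seq step) (p0 : nat).
Hypothesis pinchS : forall e p i p2 y p3 l q, assoc e y ->
  nth (inl 1) X i = inr (~~ e) -> nth (inl 1) X l = inr e ->
  (p, i, p2) \in S -> walk lab (base_steps S) p2 (base y) p3 -> (p3, l, q) \in S ->
  walk lab (base_steps S) p (base (assoc_iso e y)) q.

(** Vertex [p] can be reached from [p0] along a path that spells the normal form
    [(s, x)]: one edge labelled t^e for each letter of [s], and paths labelled in
    G in between.  An element of [assoc e] may cross t^e, as in the normal form. *)
Fixpoint reach (s : seq (G * bool)) (x : G) (p : nat) : Prop :=
  if s is (r, e) :: s' then
    exists p1 i p2 a y, [/\ reach s' (r * a) p1, assoc e a,
      (p1, i, p2) \in S /\ nth (inl 1) X i = inr e,
      walk lab (base_steps S) p2 (base y) p & x = assoc_iso e a * y]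
  else walk lab (base_steps S) p0 (base x) p.

Lemma reach_base s x p y q :
  reach s x p -> walk lab (base_steps S) p (base y) q -> reach s (x * y) q.
Proof.
case: s => [|[r e] s] /=; first by rewrite baseM; apply: walk_cat.
case=> p1 [i [p2 [a [z [Rs ea Si w ->]]]]] wq.
exists p1, i, p2, a, (z * y); split=> //; last by rewrite mulgA.
by rewrite baseM; apply: walk_cat wq.
Qed.

(** A letter t^e that cancels in the normal form closes a factor t^-e y t^e of
    the path, which [pinchS] replaces by a path labelled in G. *)
Lemma reach_walk p z q : walk lab S p z q -> forall y,
  reach (nf y).1 (nf y).2 p -> reach (nf (y * z)).1 (nf (y * z)).2 q.
Proof.
elim=> {p z q} [p y|p k q z r Spq _ IH y Ry]; first by rewrite mulg1.
rewrite mulgA; apply: IH.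
case kE: (nth (inl 1) X k) => [x|e].
  have wx : walk lab (base_steps S) p (base x) q.
    have <- : lab k = base x by rewrite /lab kE.
    by apply: walk1; rewrite mem_filter /in_base kE.
  have -> : lab k = base x by rewrite /lab kE.
  by rewrite nf_base /=; apply: reach_base Ry wx.
have -> : lab k = stable e by rewrite /lab kE.
rewrite nf_stable; move: (nf y) Ry => [s x] /= Rs; rewrite /act_t.
case: ifP => [|_] /=; last first.
  exists p, k, q, ((rep e x)^-1 * x), 1; split=> //.
  - by rewrite mulVKg.
  - exact: rep_coset.
  - by rewrite base1; apply: WalkNil.
  - by rewrite mulg1.
rewrite /cancels; case: s Rs => [|[r1 e1] s] //= Rs /andP[/eqP e1E /asboolP ex].
subst e1; case: Rs => p1 [i [p2 [a [y1 [Rs ea [Si iE] w xE]]]]].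
have eia : assoc e (assoc_iso (~~ e) a) by apply: assoc_isoNP.
have ey1 : assoc e y1.
  by rewrite -[y1](mulKg (assoc_iso (~~ e) a)) -xE; apply: assocM => //; apply: assocV.
have w1 := pinchS ey1 iE kE Si w Spq.
by rewrite xE assoc_isoM // assoc_isoNK // mulgA; apply: reach_base Rs w1.
Qed.

Lemma walk_closed q : walk lab S p0 1 q -> walk lab (base_steps S) p0 1 q.
Proof.
move=> /reach_walk/(_ 1); rewrite mulg1 nf1 /= base1; apply; exact: WalkNil.
Qed.

End Reach.

Lemma mem_pairs (S T : eqType) (s : seq S) (t : seq T) x y :
  ((x, y) \in [seq (a, b) | a <- s, b <- t]) = (x \in s) && (y \in t).
Proof.
apply/allpairsP/andP => [[[a b] [sa tb [-> ->]]] //|[sx ty]].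
by exists (x, y).
Qed.

Definition index_pairs : seq (nat * nat) :=
  [seq (i, j) | i <- iota 0 (size X), j <- iota 0 (size X)].

(** All relations of the form a b c = d between letters.  Any of them may be used
    to add an edge without changing the values of paths; those of the form
    t^-e y t^e = [assoc_iso e y] make the saturated set closed. *)
Definition pinch_table : seq ((nat * nat) * (nat * nat)) :=
  [seq x <- [seq (ij, lk) | ij <- index_pairs, lk <- index_pairs] |
     `[< lab x.1.1 * lab x.1.2 * lab x.2.1 = lab x.2.2 >]].

Lemma mem_pinch_table i j l k : ((i, j), (l, k)) \in pinch_table =
  [&& i < size X, j < size X, l < size X, k < size X &
      `[< lab i * lab j * lab l = lab k >]].
Proof.
rewrite mem_filter !mem_pairs !mem_iota !add0n /=.
by rewrite andbC -!andbA.
Qed.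

Definition pinch S t : bool :=
  has (fun t1 => has (fun t2 => has (fun t3 =>
    [&& t1.1.1 == t.1.1, t1.2 == t2.1.1, t2.2 == t3.1.1, t3.2 == t.2 &
        ((t1.1.2, t2.1.2), (t3.1.2, t.1.2)) \in pinch_table]) S) S) S.

(** [query] answers whether a given step labelled in G can be replaced by a path
    of such steps. *)
Section Decide.
Variables (V : seq nat) (query : seq step -> step -> bool).
Hypothesis query_sound : forall S p k q, in_base k ->
  query (base_steps S) (p, k, q) -> walk lab (base_steps S) p (lab k) q.

Definition endpoints_in S := forall t, t \in S -> (t.1.1 \in V) /\ (t.2 \in V).

Definition query_closed S := forall p k q, p \in V -> q \in V -> k < size X -> in_base k ->
  query (base_steps S) (p, k, q) -> (p, k, q) \in S.

Hypothesis query_complete : forall S, endpoints_in S -> query_closed S ->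
  forall p k q, p \in V -> q \in V -> k < size X -> in_base k ->
  walk lab (base_steps S) p (lab k) q -> (p, k, q) \in S.

Hypothesis assocX : forall e x, assoc e x -> inl x \in X.

Definition derives S t : bool := in_base t.1.2 && (query (base_steps S) t || pinch S t).

Definition candidates : seq step :=
  [seq (pk, q) | pk <- [seq (p, k) | p <- V, k <- iota 0 (size X)], q <- V].

Lemma mem_candidates p k q :
  (p, k, q) \in candidates = [&& p \in V, q \in V & k < size X].
Proof. by rewrite !mem_pairs mem_iota -andbA; congr (_ && _); rewrite andbC. Qed.

Lemma saturate_correct T n0 n1 k1 : endpoints_in T ->
  n0 \in V -> n1 \in V -> k1 < size X -> nth (inl 1) X k1 = inl 1 ->
  (n0, k1, n1) \in saturate candidates derives T <-> walk lab T n0 1 n1.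
Proof.
move=> endT Vn0 Vn1 k1X k1E.
have lab1 : lab k1 = 1 by rewrite /lab k1E; apply: base1.
have in_base1 : in_base k1 by rewrite /in_base k1E.
set S := saturate _ _ T.
split=> [Sn|w].
  rewrite -lab1; suff : {in S, forall t, walk lab T t.1.1 (lab t.1.2) t.2}.
    by move=> /(_ _ Sn).
  apply: saturate_ind => [[[p k] q] Tt|S' [[p k] q] wS' _]; first exact: walk1.
  have wT p' z q' : walk lab S' p' z q' -> walk lab T p' z q'.
    by apply: walk_trans => p1 k2 q1 St; apply: (wS' _ St).
  move=> /andP[/= Gk /orP[/(query_sound Gk)|]].
    by move=> w; apply/wT; move: w; apply: walk_sub => t; rewrite mem_filter => /andP[].
  move=> /hasP[[[p1 i] q1] St1] /hasP[[[p2 j] q2] St2] /hasP[[[p3 l] q3] St3] /=.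
  case/and5P=> /eqP<- /eqP q1E /eqP q2E /eqP<-; subst p2 p3.
  rewrite mem_pinch_table => /and5P[_ _ _ _ /asboolP<-].
  by apply: (walk_cat (walk_cat (wS' _ St1) (wS' _ St2)) (wS' _ St3)).
have subTS : {subset T <= S} by apply: saturate_sub.
have closedS p k q : p \in V -> q \in V -> k < size X -> derives S (p, k, q) ->
    (p, k, q) \in S.
  by move=> Vp Vq kX; apply: saturate_closed; rewrite mem_candidates Vp Vq kX.
have endS : endpoints_in S.
  apply: (saturate_ind (P := fun t => t.1.1 \in V /\ t.2 \in V)) => //.
  by move=> S' [[p k] q] _; rewrite mem_candidates => /and3P[].
have qclS : query_closed S.
  by move=> p k q Vp Vq kX Gk Q; apply: closedS => //; rewrite /derives /= Gk Q.
have gS t : t \in S -> in_base t.1.2 -> t \in base_steps S by rewrite mem_filter => -> ->.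
have labX x : inl x \in X -> exists k, [/\ k < size X, nth (inl 1) X k = inl x,
    in_base k & lab k = base x].
  move=> Xx; exists (index (inl x) X); rewrite /in_base /lab index_mem nth_index //.
apply: query_complete => //; rewrite lab1.
apply: walk_closed (walk_sub subTS w).
move=> e p i p2 y p3 l q ey iE lE Si wy Sl.
have [j [jX _ Gj jE]] := labX _ (assocX ey).
have [k [kX _ Gk kE]] := labX _ (assocX (assoc_isoP ey)).
rewrite -kE; apply: walk1; apply: gS => //.
have [/= Vp Vp2] := endS _ Si; have [/= Vp3 Vq] := endS _ Sl.
have Sj : (p2, j, p3) \in S by apply: query_complete; rewrite ?jE.
apply: closedS => //; rewrite /derives /= Gk; apply/orP/or_intror.
apply/hasP; exists (p, i, p2) => //; apply/hasP; exists (p2, j, p3) => //.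
apply/hasP; exists (p3, l, q) => //=; rewrite !eqxx mem_pinch_table.
rewrite (nth_inr_size iE) jX (nth_inr_size lE) kX /=; apply/asboolP.
rewrite jE kE -stable_conj // /lab iE lE.
by [].
Qed.

End Decide.
Lemma in_base_nth k : in_base k = nth true [seq (if l is inl _ then true else false) | l <- X] k.
Proof.
rewrite /in_base; case: (ltnP k (size X)) => [lt_k|le_k].
  by rewrite (nth_map (inl 1)).
by rewrite !nth_default ?size_map.
Qed.

Definition base_elt k : G := if nth (inl 1) X k is inl x then x else 1.

Lemma lab_in_base k : in_base k -> lab k = base (base_elt k).
Proof. by rewrite /in_base /base_elt /lab; case: (nth _ X k). Qed.

(** Completeness is asked only on sets closed under the query itself: a local
    rule such as transitivity, which follows paths only step by step, then
    qualifies. *)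
Definition decides_walks (query : seq step -> step -> bool) : Prop :=
  [/\ computable O (fun z : seq step * step => query z.1 z.2),
      forall S p k q, in_base k -> query (base_steps S) (p, k, q) ->
        walk lab (base_steps S) p (lab k) q &
      forall V S, endpoints_in V S -> query_closed V query S ->
        forall p k q, p \in V -> q \in V -> k < size X -> in_base k ->
          walk lab (base_steps S) p (lab k) q -> (p, k, q) \in S].

Section Queries.
Variables (e : bool) (g h : G).
Hypotheses (Ah : ~ A h) (Bh : ~ B h).
Hypothesis eg : e -> ~ A g.
Hypothesis gP : forall a, A a -> a <> 1 -> ~ assoc (~~ e) (g^-1 * a * g).
Let d := stable e * base g^-1 * stable false.

Variables (wu wV wh whV wd wdV : seq nat) (wX : seq (seq nat)).
Hypotheses (vu : valid_word n wu) (uE : wval wu = stable e).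
Hypotheses (vV : valid_word n wV) (VE : wval wV = (stable e)^-1).
Hypotheses (vh : valid_word n wh) (hE : wval wh = base h).
Hypotheses (vhV : valid_word n whV) (hVE : wval whV = base h^-1).
Hypotheses (vd : valid_word n wd) (dE : wval wd = d).
Hypotheses (vdV : valid_word n wdV) (dVE : wval wdV = d^-1).
Hypotheses (vX : forall k, valid_word n (nth [::] wX k)).
Hypothesis XE : forall k, wval (nth [::] wX k) = lab k.

Definition power_word (w : seq nat) (k : nat) : seq nat := flatten (nseq k w).

(** A word of value c_p x c_q^-1, c_p and c_q being markers.  The words for their
    factors and for the inverses of these are given once and for all. *)
Definition step_word (t : step) : seq nat :=
  (power_word wu t.1.1.+1 ++ wh ++ power_word wu t.1.1.+1 ++ wd) ++
  nth [::] wX t.1.2 ++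
  wdV ++ power_word wV t.2.+1 ++ whV ++ power_word wV t.2.+1.

Definition oracle_query (S : seq step) (t : step) : bool :=
  O (submonoid_code (map step_word S) (step_word t)) == 1%N.

Definition labelled (t : step) : edge := (t.1.1, base_elt t.1.2, t.2).

Lemma power_word_val w k : wval (power_word w k) = wval w ^+ k.
Proof.
elim: k => [|k IHk]; first exact: word_val_nil.
by rewrite /power_word /= word_val_cat IHk expgS.
Qed.

Lemma power_word_valid w k : valid_word n w -> valid_word n (power_word w k).
Proof.
move=> vw; elim: k => // k IHk.
by rewrite /valid_word /power_word /= all_cat; apply/andP; split.
Qed.

Lemma step_word_valid t : valid_word n (step_word t).
Proof.
have := power_word_valid t.1.1.+1 vu; have := power_word_valid t.2.+1 vV.
rewrite /step_word; move: (power_word wu _) (power_word wV _) (nth _ _ _) (vX t.1.2).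
move=> a b c; move: vh vhV vd vdV; rewrite /valid_word !all_cat.
by do 7!move=> ->.
Qed.

Lemma step_word_val t :
  wval (step_word t) = marker e h d t.1.1 * lab t.1.2 * (marker e h d t.2)^-1.
Proof.
have := power_word_val wu t.1.1.+1; have := power_word_val wV t.2.+1.
rewrite /step_word; move: (power_word wu _) (power_word wV _) => a b bE aE.
by rewrite !word_val_cat aE bE uE VE hE hVE dE dVE XE markerV /marker !mulgA.
Qed.

Lemma labelled_val t : in_base t.1.2 -> wval (step_word t) = edge_val e h d (labelled t).
Proof. by move=> Gt; rewrite step_word_val lab_in_base. Qed.

(** The steps labelled in G become generators c_p x c_q^-1 of a submonoid, in
    which [edge_of_product] recognizes the values of paths. *)
Lemma oracle_queryP S p k q : in_base k ->
  reflect (walk lab (base_steps S) p (lab k) q) (oracle_query (base_steps S) (p, k, q)).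
Proof.
move=> Gk; rewrite /oracle_query char_funP.
have vS : all (valid_word n) (map step_word (base_steps S)).
  by apply/allP => _ /mapP[t _ ->]; apply: step_word_valid.
have vt := step_word_valid (p, k, q).
have GS (u : seq step) : {subset u <= base_steps S} -> forall t, t \in u -> in_base t.1.2.
  by move=> uS t /uS; rewrite mem_filter => /andP[].
have valu (u : seq step) : {subset u <= base_steps S} ->
    wval (flatten (map step_word u)) = edges_val e h d (map labelled u).
  elim: u => [|t u IHu] uS; first by rewrite word_val_nil /edges_val big_nil.
  rewrite /= word_val_cat edges_val_cons IHu; last first.
    by move=> t' ut'; apply: uS; rewrite inE ut' orbT.
  by rewrite labelled_val // (GS _ uS) ?mem_head.
apply: (iffP (asboolP _)) => [/(submonoid_problem_code gen vS vt)|w].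
  case=> _ /subset_map_seq[u uS ->]; rewrite valu // labelled_val // => /esym uE1.
  pose P (t : edge) := walk lab (base_steps S) t.1.1 (base t.1.2) t.2.
  have PM a x b y c : P (a, x, b) -> P (b, y, c) -> P (a, x * y, c).
    by rewrite /P /= baseM; apply: walk_cat.
  have Pu : {in map labelled u, forall t : edge, P t}.
    move=> _ /mapP[[[a l] b] ut ->]; rewrite /P /= -lab_in_base; last exact: GS ut.
    exact/walk1/uS.
  have [] := edge_of_product Ah Bh eg gP erefl PM Pu uE1; rewrite /P /= lab_in_base //.
  by case=> /= -> ->; rewrite base1; apply: WalkNil.
apply/(submonoid_problem_code gen vS vt).
have [u uS uE1] : exists2 u, {subset u <= base_steps S} &
    wval (flatten (map step_word u)) = marker e h d p * lab k * (marker e h d q)^-1.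
  elim: w => {p k q Gk vt} [p|p k q z r Sp _ [u uS uE1]].
    by exists [::]; rewrite // word_val_nil mulg1 mulgV.
  exists ((p, k, q) :: u).
    by move=> t; rewrite inE => /orP[/eqP->|/uS].
  rewrite /= word_val_cat uE1 step_word_val /=.
  move: (marker e h d p) (marker e h d q) (marker e h d r) => mp mq mr.
  by rewrite !mulgA mulgVK.
exists (map step_word u); last by rewrite step_word_val uE1.
by move=> _ /mapP[t /uS St ->]; apply: map_f.
Qed.

Lemma oracle_query_decides : decides_walks oracle_query.
Proof.
split=> [|S p k q Gk /(oracle_queryP _ _ _ Gk)//|].
  rewrite /oracle_query /submonoid_code /step_word /power_word.
  by computability.
move=> V S _ clS p k q Vp Vq kX Gk w; apply: clS => //.
exact/(oracle_queryP _ _ _ Gk).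
Qed.

End Queries.

(** When G is trivial all the values are equal, so one step of transitivity at a
    time decides which paths exist. *)
Definition local_query (S : seq step) (t : step) : bool :=
  (t.1.1 == t.2) || has (fun t1 => has (fun t2 =>
    [&& t1.1.1 == t.1.1, t1.2 == t2.1.1 & t2.2 == t.2]) S) S.

Lemma local_query_decides : (forall x : G, x = 1) -> decides_walks local_query.
Proof.
move=> G1; have lab1 k : in_base k -> lab k = 1.
  by move=> Gk; rewrite lab_in_base // (G1 (base_elt k)) base1.
split; first by rewrite /local_query; computability.
  move=> S p k q Gk /orP[/eqP/= <-|]; first by rewrite lab1 //; apply: WalkNil.
  case/hasP=> [[[p1 k1] q1] S1] /hasP[[[p2 k2] q2] S2] /=.
  case/and3P=> /eqP<- /eqP q1E /eqP<-; subst p2.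
  have in_baseS t : t \in base_steps S -> in_base t.1.2 by rewrite mem_filter => /andP[].
  have := walk_cat (walk1 lab S1) (walk1 lab S2).
  by rewrite !lab1 ?mulg1 //; [apply: in_baseS S2|apply: in_baseS S1].
move=> V S endS clS p k q Vp Vq kX Gk w.
elim: w Vp Vq => {p q} [p Vp _|p k' m z q Sp _ IH Vp Vq].
  by apply: clS; rewrite // /local_query eqxx.
have Vm : m \in V by move: Sp; rewrite mem_filter => /andP[_ /endS[]].
apply: clS => //; apply/orP/or_intror/hasP; exists (p, k', m) => //.
apply/hasP; exists (m, k, q); rewrite /= ?eqxx // mem_filter /= Gk.
exact: IH.
Qed.

Lemma query_exists : exists query, decides_walks query.
Proof.
have [[e [g [h [Ah Bh eg gP]]]]|G1] := free_or_trivial; last first.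
  by exists local_query; apply: local_query_decides.
pose d := stable e * base g^-1 * stable false.
have [wu [vu uE]] := word_of (stable e).
have [wV [vV VE]] := word_of (stable e)^-1.
have [wh [vh hE]] := word_of (base h).
have [whV [vhV hVE]] := word_of (base h^-1).
have [wd [vd dE]] := word_of d.
have [wdV [vdV dVE]] := word_of d^-1.
have [f fP] := choice (fun k => word_of (lab k)).
pose wX := map f (iota 0 (size X)).
have XP k : valid_word n (nth [::] wX k) /\ wval (nth [::] wX k) = lab k.
  case: (ltnP k (size X)) => [lt_k|le_k].
    by rewrite (nth_map 0) ?size_iota // nth_iota.
  rewrite nth_default ?size_map ?size_iota // word_val_nil /lab nth_default //.
  by split=> //; rewrite -base1.
exists (oracle_query wu wV wh whV wd wdV wX).
apply: (@oracle_query_decides e g h) => //.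
- by move=> k; have [] := XP k.
- by move=> k; have [] := XP k.
Qed.

End Alphabet.

(** * From rational subsets to submonoids *)

Lemma computable_in_base Q X (E : countType) (f : E -> nat) :
  computable Q f -> computable Q (fun x => in_base X (f x)).
Proof.
move=> cf; apply: (@computable_ext _ _ _ (fun x =>
  nth true [seq (if l is inl _ then true else false) | l <- X] (f x))).
  by move=> x; rewrite in_base_nth.
by computability.
Qed.

Definition vertices (T : seq step) : seq nat :=
  [:: node [::] 0; node [::] 1%N] ++ map (fun t => t.1.1) T ++ map snd T.

Lemma computable_saturate Q X (E : countType) (T : E -> seq step) query :
  computable Q T -> computable Q (fun z : seq step * step => query z.1 z.2) ->
  computable Q (fun x => saturate (candidates X (vertices (T x))) (derives X query) (T x)).
Proof.
move=> cT cq; have cG := @computable_in_base Q X nat id (computable_id _ _).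
rewrite /saturate /sat_step /candidates /vertices /derives /pinch /base_steps.
by computability.
Qed.

Section Reduction.
Variable sAB : seq G.
Hypothesis sABP : forall e x, assoc e x -> x \in sAB.

(** A word over G and t^+1, t^-1 for the generator coded by [k], or for its
    inverse when [b] is true. *)
Definition letter_word (b : bool) (k : nat) : hnn_word G :=
  let z := letter_of_code gen k in if b then repr z^-1 else repr z.

Definition alphabet : seq (G + bool) :=
  inl 1 :: flatten [seq letter_word false k ++ letter_word true k | k <- iota 0 n.*2]
    ++ map inl sAB.

Local Notation lab := (lab alphabet).

Definition spell (u : hnn_word G) : seq nat := map (index^~ alphabet) u.

Lemma spell_val u : {subset u <= alphabet} -> word_val lab (spell u) = hnn_pi A phi u.
Proof.
elim: u => [|l u IHu] ua; first exact: word_val_nil.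
rewrite /spell /= word_val_cons IHu; last by move=> l' ul'; apply: ua; rewrite inE ul' orbT.
by rewrite /lab nth_index ?ua ?mem_head // -[LHS]hnn_pi_cat.
Qed.

Definition spellings (b : bool) : seq (seq nat) :=
  [seq spell (letter_word b k) | k <- iota 0 n.*2].

Lemma spellings_val b k : valid_letter n k -> word_val lab (nth [::] (spellings b) k) =
  if b then (letter_of_code gen k)^-1 else letter_of_code gen k.
Proof.
rewrite /valid_letter => lt_k.
rewrite (nth_map 0) ?size_iota // nth_iota // spell_val.
  by rewrite /letter_word; case: b; rewrite hnn_piK.
move=> l kl; rewrite inE mem_cat; apply/orP/or_intror/orP/or_introl/flattenP.
exists (letter_word false k ++ letter_word true k).
  by apply: map_f; rewrite mem_iota.
by rewrite mem_cat; case: b kl => ->; rewrite ?orbT.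
Qed.

Definition inverse_spelling (w : seq nat) : seq nat :=
  flatten [seq nth [::] (spellings true) k | k <- rev w].

Lemma inverse_spelling_val w : valid_word n w ->
  word_val lab (inverse_spelling w) = (wval w)^-1.
Proof.
elim: w => [|k w IHw] /=; first by rewrite !word_val_nil invg1.
case/andP=> vk vw; rewrite /inverse_spelling rev_cons map_rcons flatten_rcons.
by rewrite word_val_cat [word_val lab (flatten _)]IHw // spellings_val // word_val_cons invgM.
Qed.

(** The automaton followed by the inverse of [w]: its states are shifted by two
    to make room for a new initial vertex 0 and a new final vertex 1. *)
Definition word_edges (I F : seq nat) (T : seq (nat * nat * nat)) (w : seq nat) :
    seq (nat * seq nat * nat) :=
  [seq (0, [::], p.+2) | p <- I] ++
  [seq (t.1.1.+2, nth [::] (spellings false) t.1.2, t.2.+2) | t <- T] ++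
  [seq (q.+2, inverse_spelling w, 1%N) | q <- F].

Lemma word_edges_walk I F T w :
  {in T, forall t : nat * nat * nat, valid_letter n t.1.2} -> valid_word n w ->
  (exists p q, [/\ p \in I, q \in F & walk (letter_of_code gen) T p (wval w) q]) <->
  walk (word_val lab) (word_edges I F T w) 0 1 1%N.
Proof.
move=> vT vw; set E := word_edges I F T w.
have EP p u q : (p, u, q) \in E ->
  [\/ exists i, [/\ p = 0, u = [::], q = i.+2 & i \in I],
      exists t, [/\ t \in T, p = t.1.1.+2, u = nth [::] (spellings false) t.1.2 &
        q = t.2.+2] |
      exists i, [/\ i \in F, p = i.+2, u = inverse_spelling w & q = 1%N]].
  rewrite !mem_cat => /or3P[] /mapP[i i_in [-> -> ->]].
  - by apply: Or31; exists i.
  - by apply: Or32; exists i.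
  - by apply: Or33; exists i.
split=> [[p [q [Ip Fq wpq]]]|].
  rewrite -(mulgV (wval w)) -[wval w]mul1g -{1}(word_val_nil lab) -mulgA.
  apply: (@WalkCons _ _ _ _ 0 [::] p.+2).
    by rewrite mem_cat (map_f (fun p => (0, [::], p.+2)) Ip).
  apply: (walk_cat (q := q.+2)); last first.
    rewrite mul1g -inverse_spelling_val //; apply: walk1.
    by rewrite !mem_cat (map_f (fun q => (q.+2, inverse_spelling w, 1%N))) ?orbT.
  elim: wpq => {p q Ip Fq} [p|p k q z r Tp _ IH]; first exact: WalkNil.
  rewrite -(spellings_val false (vT _ Tp)); apply: WalkCons IH.
  rewrite !mem_cat; apply/or3P/Or32; apply: (map_f (fun t =>
    (t.1.1.+2, nth [::] (spellings false) t.1.2, t.2.+2)) Tp).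
have end1 a z b : walk (word_val lab) E a z b -> a = 1%N -> z = 1.
  case=> // p u q y r /EP[] [i []] => [-> //|_ -> //|_ -> //].
have H a z b : walk (word_val lab) E a z b -> b = 1%N -> forall p, a = p.+2 ->
    exists2 q, q \in F & walk (letter_of_code gen) T p (z * wval w) q.
  elim=> {a z b} [a -> //|a u c z b /EP ac cb IH b1 p ap].
  case: ac => -[i []]; first by rewrite ap.
    move=> Ti aE uE cE; have [q Fq wq] := IH b1 _ cE; exists q => //.
    move: aE; rewrite ap uE => -[->]; rewrite spellings_val ?vT // -mulgA.
    by apply: WalkCons wq; case: (i) Ti => -[].
  move=> Fi aE uE cE; move: aE; rewrite ap => -[->]; exists i => //.
  rewrite uE inverse_spelling_val // (end1 _ _ _ cb cE) mulg1 mulVg.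
  exact: WalkNil.
move=> w01; have {w01} : exists a z b, [/\ walk (word_val lab) E a z b, a = 0, b = 1%N & z = 1].
  by exists 0, 1, 1%N.
case=> _ [_ [_ [[a|a u c z b /EP ac cb]]]]; first by move=> ->.
move=> a0 b1 uz1; case: ac => -[i []]; [|by move=> _; rewrite a0..].
move=> _ uE cE Ii; have [q Fq wq] := H _ _ _ cb b1 _ cE.
exists i, q; split=> //; suff <- : z * wval w = wval w by [].
by move: uz1; rewrite uE word_val_nil mul1g => ->; rewrite mul1g.
Qed.

Definition instance_steps (x : nat) : seq step :=
  expand 0 (word_edges (inst_states 0 x) (inst_states 1 x) (inst_steps x) (inst_word x)).

(** In the alphabet the letter 0 is the identity of G, so the edge in question is
    a path of value 1 from the initial to the final vertex. *)
Lemma instance_stepsP query x : decides_walks alphabet query -> valid_rational n x ->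
  rational_problem gen x <->
  (node [::] 0, 0, node [::] 1%N) \in
    saturate (candidates alphabet (vertices (instance_steps x)))
      (derives alphabet query) (instance_steps x).
Proof.
case=> _ sound complete vx; have /and4P[_ _ /allP vT vw] := vx.
have lab1 : lab 0 = 1 by rewrite -base1.
rewrite rational_problemE.
have -> : forall P, (valid_rational n x /\ P) <-> P.
  by move=> P; split=> [[]|].
rewrite word_edges_walk //; last first.
  by move=> _ /mapP[y /vT/andP[_ vy] ->].
rewrite -(expand_walk lab1).
apply: iff_sym; apply: saturate_correct => //.
- exact: complete.
- move=> e y ey; rewrite /alphabet inE mem_cat (map_f inl) ?orbT //.
  exact: sABP ey.
- move=> t Tt; split; rewrite !mem_cat; apply/or3P.
    by apply/Or32/map_f.
  by apply/Or33/map_f.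
Qed.

Lemma rational_to_submonoid :
  turing_reducible (rational_problem gen) (submonoid_problem gen).
Proof.
have [query qP] := query_exists alphabet.
have [cq _ _] := qP.
apply: (@turing_reducible_computable _ _ (fun x => valid_rational n x &&
  ((node [::] 0, 0, node [::] 1%N) \in
    saturate (candidates alphabet (vertices (instance_steps x)))
      (derives alphabet query) (instance_steps x)))).
  move=> x; split=> [Px|/andP[vx]]; last by rewrite -instance_stepsP.
  have /rational_problemE[vx _] := Px.
  by rewrite vx; apply/instance_stepsP.
have csteps : computable O instance_steps.
  rewrite /instance_steps /expand /word_edges /inst_states /inst_steps /suffix_steps.
  rewrite /inverse_spelling /inst_word /node.
  by computability.
have csat := computable_saturate alphabet csteps cq.
apply: (computable_andb (computable_valid_rational _ n)); apply: computable_mem csat.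
exact: computable_const.
Qed.

End Reduction.
End HNNExtension.

Local Open Scope classical_set_scope.
Local Open Scope group_scope.

Theorem theorem5 (G : groupType) (A B : set G) (phi : G -> G)
  (fgG : finitely_generated G)
  (sgA : is_subgroup A) (sgB : is_subgroup B)
  (finA : finite_set A) (finB : finite_set B)
  (isoAB : is_isomorphism A B phi)
  (exg : exists g : G,
     conj_set A g `&` A = [set 1] \/ conj_set A g `&` B = [set 1])
  (n : nat) (s : 'I_n -> hnn A phi)
  (injs : injective s) (gens : generates s) :
  recursively_equivalent (rational_problem s) (submonoid_problem s).
Proof.
split; last exact: submonoid_to_rational.
have [[sA AE] [sB BE]] : (exists sA : seq G, A = [set` sA]) /\ exists sB : seq G, B = [set` sB].
  by split; apply/finite_seqP.
have sABP e x : assoc A B e x -> x \in sA ++ sB.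
  by rewrite /assoc mem_cat AE BE; case: e => /= ->; rewrite ?orbT.
exact: rational_to_submonoid sABP.
Qed.
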